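(* For arbitrarily large values of $n$, there are graphs on $n$ vertices such that constructing a circle packing for the graph on a root computation tree requires degree $\Omega(n^{0.677})$. If there exist infinitely many Sophie Germain primes, then there are graphs for which constructing a circle packing requires degree $\Omega(n)$.
   Context: A circle packing representing a planar graph $G$ is a collection of circles in the plane with pairwise disjoint interiors, one per vertex, such that the circles of adjacent vertices are tangent; constructing it means computing all centers (as complex numbers) and radii. An algebraic computation tree is a rooted tree whose computation nodes compute a value as the sum, difference, product or quotient of integer constants and values computed at ancestor nodes, and whose decision nodes test whether a computed value is greater than zero and branch. A root computation tree additionally allows computing a complex root of a univariate polynomial whose coefficients are integers or previously computed values, and complex conjugation; its degree is the maximum degree of any polynomial used. A Sophie Germain prime is a prime $p$ such that $2p+1$ is also prime. *)

(* Defs.v *)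
(* Complex numbers are modelled by algC (algebraic complex
   numbers). *)
From mathcomp Require Import all_boot all_order all_algebra all_field.
Set Implicit Arguments. Unset Strict Implicit. Unset Printing Implicit Defensive.
Import Order.TTheory GRing.Theory Num.Theory.
Local Open Scope ring_scope.

(* ---------- Circle packings ---------- *)

(* A simple graph on the vertex set 'I_n: a symmetric irreflexive relation. *)
Definition simple_graph (n : nat) (e : rel 'I_n) : Prop :=
  (forall i, ~~ e i i) /\ (forall i j, e i j = e j i).

(* Circle i has center c i (a complex number) and radius r i (a positive real).
   Interiors are pairwise disjoint, and circles of adjacent vertices are
   tangent (necessarily externally, since interiors are disjoint). *)
Definition circle_packing (n : nat) (e : rel 'I_n) (c r : 'I_n -> algC) : Prop :=
  (forall i, 0 < r i) /\
  (forall i j, i != j -> r i + r j <= `|c i - c j|) /\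
  (forall i j, e i j -> `|c i - c j| = r i + r j).

(* ---------- Root computation trees ---------- *)

(* An argument of an operation: an integer constant or the value computed at
   an ancestor node (referred to by its position in the list of values
   computed so far along the path from the root). *)
Inductive operand := OConst of int | OVal of nat.

Inductive arith_op := OpAdd | OpSub | OpMul | OpDiv.

Inductive rtree :=
  | RLeaf  of seq (nat * nat)
      (* output: for the k-th vertex, the positions of its center and radius *)
  | RArith of arith_op & operand & operand & rtree
      (* compute a op b *)
  | RConj  of operand & rtree
      (* compute the complex conjugate *)
  | RRoot  of seq operand & rtree
      (* compute a complex root of the polynomial with the given coefficient
         list (constant coefficient first) *)
  | RDec   of operand & rtree & rtree.
      (* test whether the value is > 0; first subtree if yes, second if no *)

Definition eval_operand (env : seq algC) (a : operand) : option algC :=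
  match a with
  | OConst z => Some (z%:~R)
  | OVal k => if (k < size env)%N then Some (nth 0 env k) else None
  end.

Definition eval_operands (env : seq algC) (s : seq operand) : option (seq algC) :=
  foldr (fun a acc => match eval_operand env a, acc with
                      | Some x, Some l => Some (x :: l)
                      | _, _ => None end) (Some [::]) s.

Definition arith (op : arith_op) (x y : algC) : algC :=
  match op with
  | OpAdd => x + y | OpSub => x - y | OpMul => x * y | OpDiv => x / y
  end.

(* [run env t out]: starting with the values [env] already computed, some
   execution of [t] reaches a leaf that outputs [out] (a list of
   (center, radius) pairs).  Division by zero, references to non-existent
   values, or root computation for the zero polynomial (or a polynomial
   with no root) abort the execution.  The choice of the root is arbitrary. *)
Inductive run : seq algC -> rtree -> seq (algC * algC) -> Prop :=
  | run_leaf env (s : seq (nat * nat)) :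
      all (fun p => (p.1 < size env)%N && (p.2 < size env)%N) s ->
      run env (RLeaf s) [seq (nth 0 env p.1, nth 0 env p.2) | p <- s]
  | run_arith env op a b x y t out :
      eval_operand env a = Some x -> eval_operand env b = Some y ->
      (op = OpDiv -> y != 0) ->
      run (rcons env (arith op x y)) t out ->
      run env (RArith op a b t) out
  | run_conj env a x t out :
      eval_operand env a = Some x ->
      run (rcons env x^*) t out ->
      run env (RConj a t) out
  | run_root env cs xs z t out :
      eval_operands env cs = Some xs ->
      Poly xs != 0 -> root (Poly xs) z ->
      run (rcons env z) t out ->
      run env (RRoot cs t) out
  | run_dec_pos env a x t1 t2 out :
      eval_operand env a = Some x -> 0 < x ->
      run env t1 out -> run env (RDec a t1 t2) out
  | run_dec_npos env a x t1 t2 out :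
      eval_operand env a = Some x -> ~~ (0 < x) ->
      run env t2 out -> run env (RDec a t1 t2) out.

(* Degree of a tree: the maximum degree of a polynomial used at a root node
   (a polynomial given by k coefficients has degree k - 1); 0 if none. *)
Fixpoint rdegree (t : rtree) : nat :=
  match t with
  | RLeaf _ => 0
  | RArith _ _ _ t' => rdegree t'
  | RConj _ t' => rdegree t'
  | RRoot cs t' => maxn (size cs).-1 (rdegree t')
  | RDec _ t1 t2 => maxn (rdegree t1) (rdegree t2)
  end%N.

(* The tree outputs the circle packing given by [out]. *)
Definition output_packing (n : nat) (e : rel 'I_n) (out : seq (algC * algC)) :=
  size out = n /\
  circle_packing e (fun i => (nth (0, 0) out i).1) (fun i => (nth (0, 0) out i).2).

(* The tree [t] constructs a circle packing of the graph: it has at least one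
   complete execution, and every complete execution outputs a circle packing
   representing the graph. *)
Definition constructs_packing (n : nat) (e : rel 'I_n) (t : rtree) : Prop :=
  (exists out, run [::] t out) /\
  (forall out, run [::] t out -> output_packing e out).

Definition sophie_germain (p : nat) : bool := prime p && prime p.*2.+1.

(* Main.v *)
Require Import Defs.
From mathcomp Require Import all_boot all_order all_algebra all_field.
From mathcomp Require Import ring lra zify.
Import Order.TTheory GRing.Theory Num.Theory.
Set Implicit Arguments. Unset Strict Implicit. Unset Printing Implicit Defensive.
Local Open Scope ring_scope.

(* A linear lower bound holds unconditionally, which yields both parts. In the
   graph, a hub is surrounded by a ring of 2p petals, where p is odd; a first cap
   touches half of the ring, from petal 0 to petal p, a second cap touches the
   other half, and a top disc touches both caps and the petals 0 and p. Between
   the hub and a cap the petals form a Steiner chain, of half-angle a say; the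
   two chains share their end discs, so they have the same angle, and the top
   disc forces (sin(pa)/sin(a))^2 = 1 + cos(a)^2. For t = 2 cos(2a) and
   p = 2m + 3 this says 4 U_(m+1)(t) U_m(t) = 1, where U_n is the monic
   polynomial with U_n(2 cos x) = sin((n+1)x) / sin(x). Every solution has
   2-adic valuation -2/q, where q = 2m + 1, so q divides the degree of t.
   As t is a rational function of the centers and radii and their conjugates,
   a root computation tree reaches it through a tower of extensions of degree
   at most the degree of the tree; if q is prime, that degree is at least q. *)

(** * Towers of number fields *)

(** A tree may output any packing of the graph, so [t] has to be the same for all of them: it is
    read off the inversive distance of the hub and the first cap. The graph has 6p + 6 edges on 2p +
    4 vertices, hence is a triangulation, and rigidity up to Möbius maps is to be expected; it is
    not quoted, the tangency equations are solved directly. Existence and rigidity share one model.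
    A disc tangent to the hub is a plane vector up to sign; two such discs are tangent when the
    determinant is 1 or -1, and disjoint when its absolute value is at least 1. A chain of discs is
    then a linear recurrence of order two, solved by Chebyshev polynomials, so angles never appear
    and everything works over a real closed field such as [algR]. The equation for [t] need not be
    irreducible: the valuation argument applies to whichever factor has [t] as a root. The 2 in -2/q
    comes from 4 = 2^2, and is cancelled because q is odd. *)

Definition subfield_pred (S : algC -> Prop) : Prop :=
  [/\ S 1, forall x y, S x -> S y -> S (x - y)
   & forall x y, S x -> S y -> S (x / y)].

Section SubfieldPred.
Variables (S : algC -> Prop) (fS : subfield_pred S).

Lemma subfield1 : S 1. Proof. by case: fS. Qed.
Lemma subfieldB x y : S x -> S y -> S (x - y). Proof. by case: fS => _ + _; apply. Qed.
Lemma subfield_div x y : S x -> S y -> S (x / y). Proof. by case: fS => _ _; apply. Qed.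
Lemma subfield0 : S 0. Proof. by rewrite -(subrr 1); apply: subfieldB subfield1 subfield1. Qed.
Lemma subfieldN x : S x -> S (- x). Proof. by rewrite -sub0r; apply/subfieldB/subfield0. Qed.
Lemma subfieldD x y : S x -> S y -> S (x + y).
Proof. by move=> Sx Sy; rewrite -[y]opprK; apply/subfieldB/subfieldN. Qed.
Lemma subfieldV x : S x -> S x^-1.
Proof. by rewrite -[x^-1]mul1r; apply/subfield_div/subfield1. Qed.
Lemma subfieldM x y : S x -> S y -> S (x * y).
Proof. by move=> Sx Sy; rewrite -[y]invrK; apply/subfield_div/subfieldV. Qed.
Lemma subfieldX x n : S x -> S (x ^+ n).
Proof.
move=> Sx; elim: n => [|n IHn]; first exact: subfield1.
by rewrite exprS; apply: subfieldM.
Qed.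
Lemma subfield_nat n : S n%:R.
Proof.
elim: n => [|n IHn]; first exact: subfield0.
by rewrite -natr1; apply/subfieldD/subfield1.
Qed.
Lemma subfield_int (m : int) : S m%:~R.
Proof.
by case: m => n; rewrite ?NegzE ?rmorphN /=; [|apply: subfieldN]; apply: subfield_nat.
Qed.
End SubfieldPred.

Definition generated (s : seq algC) (x : algC) : Prop :=
  forall S, subfield_pred S -> (forall y, y \in s -> S y) -> S x.

Lemma generated_subfield s : subfield_pred (generated s).
Proof.
split=> [S fS _|x y Gx Gy S fS sS|x y Gx Gy S fS sS]; first exact: subfield1.
  by apply: subfieldB => //; [apply: Gx | apply: Gy].
by apply: subfield_div => //; [apply: Gx | apply: Gy].
Qed.

Lemma generated_mem s x : x \in s -> generated s x.
Proof. by move=> sx S _; apply. Qed.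

Lemma generated_sub s s' x : {subset s <= s'} -> generated s x -> generated s' x.
Proof.
move=> ss' Gx; apply: Gx; first exact: generated_subfield.
by move=> y /ss'; apply: generated_mem.
Qed.

Inductive tower (k : nat) : seq algC -> Prop :=
| tower_nil : tower k [::]
| tower_rcons s z (p : {poly algC}) : tower k s -> p != 0 -> (size p <= k.+1)%N ->
    (forall i, generated s p`_i) -> root p z -> tower k (rcons s z).

Lemma memv_subfield_pred {L : fieldExtType rat} (f : {rmorphism L -> algC})
    (K : {subfield L}) : subfield_pred (fun x => exists2 a, a \in K & f a = x).
Proof.
split; first by exists 1; rewrite ?rmorph1 ?mem1v.
  by move=> _ _ [a Ka <-] [b Kb <-]; exists (a - b); rewrite ?rmorphB ?memvB.
by move=> _ _ [a Ka <-] [b Kb <-]; exists (a / b); rewrite ?fmorph_div ?memvM ?memvV.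
Qed.

Lemma generated_image {L : fieldExtType rat} (f : {rmorphism L -> algC}) s x :
  generated (map f s) x -> exists2 a, a \in <<1 & s>>%VS & f a = x.
Proof.
move=> Gx; apply: (Gx _ (memv_subfield_pred f <<1 & s>>%AS)).
by move=> _ /mapP[a sa ->]; exists a => //; apply: seqv_sub_adjoin.
Qed.

(** The prime subfield of [L] consists of the rationals, so [minPoly 1 a] and [minCpoly (f a)] come
    from monic rational polynomials that divide each other. *)
Lemma adjoin_degree_minCpoly {L : fieldExtType rat} (f : {rmorphism L -> algC}) a :
  adjoin_degree 1 a = (size (minCpoly (f a))).-1.
Proof.
have fin (p : {poly rat}) : map_poly f (map_poly (in_alg L) p) = map_poly ratr p.
  rewrite -map_poly_comp; apply: eq_map_poly => b /=.
  by rewrite alg_num_field fmorph_rat.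
have [r [Dr mon_r] dv_r] := minCpolyP (f a).
have rts (p : {poly rat}) : root (map_poly (in_alg L) p) a = (r %| p).
  by rewrite -dv_r -fin fmorph_root.
have [m Dm] : {m : {poly rat} | minPoly 1 a = map_poly (in_alg L) m}.
  exact/sig_eqW/polyOver1P/minPolyOver.
have -> : adjoin_degree 1 a = (size (minPoly 1 a)).-1 by rewrite size_minPoly.
congr _.-1; rewrite Dr Dm !size_map_poly; apply/eqP; rewrite eqn_leq.
apply/andP; split; last first.
  apply: dvdp_leq; last by rewrite -rts -Dm root_minPoly.
  by rewrite -(map_poly_eq0 (in_alg L)) -Dm monic_neq0 ?monic_minPoly.
rewrite -(size_map_poly (in_alg L)) -Dm -[size r](size_map_poly (in_alg L)).
apply: dvdp_leq; first by rewrite map_poly_eq0 monic_neq0.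
apply: minPoly_dvdp; last by rewrite rts.
by apply/polyOver1P; exists r.
Qed.

(** The dimension is a product of step degrees, each positive and at most [k < q]; a prime [q]
    divides none of them, hence not their product. *)
Lemma tower_dim k s (L : fieldExtType rat) (f : {rmorphism L -> algC}) s1 q :
  tower k s -> map f s1 = s -> prime q -> (k < q)%N -> ~~ (q %| \dim <<1 & s1>>)%N.
Proof.
move=> tow_s def_s q_pr ltkq; elim: tow_s => [|{}s z p _ IHs p_neq0 szp Gp pz0] in s1 def_s *.
  case: s1 def_s => // _.
  by rewrite Fadjoin_nil dimv1 dvdn1 -(negbK (q == 1%N)) neq_ltn prime_gt1 ?orbT.
case/lastP: s1 => [|s1 z1] in def_s *; first by case: (s) def_s.
move: def_s; rewrite map_rcons => /rcons_inj[def_s def_z].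
rewrite adjoin_rcons dim_Fadjoin Euclid_dvdM // negb_or IHs // andbT.
set K := <<1 & s1>>%AS.
have coef i : {c | (c \in K) && (f c == p`_i)}.
  apply: sigW; have := Gp i; rewrite -def_s => /generated_image[c Kc fc].
  by exists c; rewrite Kc fc eqxx.
pose p1 := \poly_(i < size p) sval (coef i).
have fp1 : map_poly f p1 = p.
  apply/polyP=> i; rewrite coef_map coef_poly; case: ifP => [_|].
    by case: (coef i) => c /= /andP[_ /eqP].
  by rewrite ltnNge => /negbFE pi; rewrite /= rmorph0 nth_default.
suff le_k : (adjoin_degree K z1 <= k)%N by rewrite gtnNdvd // (leq_ltn_trans le_k).
rewrite -ltnS -size_minPoly (leq_trans _ szp) // -fp1 size_map_poly.
apply: dvdp_leq; first by rewrite -(map_poly_eq0 f) fp1.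
apply: minPoly_dvdp; last by rewrite -(fmorph_root f) fp1 def_z.
apply/polyOverP => i; rewrite coef_poly; case: ifP => _; last exact: mem0v.
by case: (coef i) => c /= /andP[].
Qed.

Lemma tower_degree k s y q : tower k s -> generated s y -> prime q ->
  (q %| (size (minCpoly y)).-1)%N -> (q <= k)%N.
Proof.
move=> tow_s Gy q_pr; rewrite leqNgt; apply: contraTN => ltkq.
have [L [f [s1 def_s _]]] := num_field_exists s.
have := tower_dim tow_s def_s q_pr ltkq.
apply: contra => q_dvd; rewrite -def_s in Gy.
have [y1 y1K fy1] := generated_image Gy.
apply: (dvdn_trans (n := \dim <<1; y1>>)).
  by rewrite dim_Fadjoin dimv1 muln1 (adjoin_degree_minCpoly f) fy1.
by apply: field_dimS; apply/FadjoinP; rewrite sub1v.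
Qed.

Definition conj_closed (s : seq algC) : Prop := forall x, x \in s -> generated s x^*.

Lemma generated_conj s x : conj_closed s -> generated s x -> generated s x^*.
Proof.
move=> Js Gx; have fG := generated_subfield s.
suff fJ : subfield_pred (fun x => generated s x^*) by exact: (Gx _ fJ Js).
split=> [|a b Ga Gb|a b Ga Gb].
- by rewrite rmorph1; apply: (subfield1 fG).
- by rewrite rmorphB; apply: (subfieldB fG).
by rewrite fmorph_div; apply: (subfield_div fG).
Qed.

Lemma generated_operand s (env : seq algC) a x : {in env, forall y, generated s y} ->
  eval_operand env a = Some x -> generated s x.
Proof.
move=> Genv; case: a => [m|i] /=.
  by case=> <-; apply: (subfield_int (generated_subfield s)).
  by case: ifP => // lti [<-]; apply: Genv; apply: mem_nth.
Qed.

Lemma generated_operands s (env : seq algC) cs xs : {in env, forall y, generated s y} ->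
  eval_operands env cs = Some xs ->
  size xs = size cs /\ {in xs, forall y, generated s y}.
Proof.
move=> Genv; elim: cs xs => [|a cs IHcs] xs /=; first by case=> <-.
case Ea: eval_operand => [x|] //.
rewrite -/(eval_operands env cs); case Ecs: eval_operands => [l|] // [<-].
have [<- Gl] := IHcs _ Ecs; split=> // y; rewrite inE => /predU1P[->|/Gl//].
exact: generated_operand Ea.
Qed.

Lemma generated_rcons s (env : seq algC) x : {in env, forall y, generated s y} ->
  generated s x -> {in rcons env x, forall y, generated s y}.
Proof. by move=> Genv Gx y; rewrite mem_rcons inE => /predU1P[->|/Genv]. Qed.

(* Each root node adjoins the chosen root together with its complex conjugate,
   so that conjugation nodes stay inside the tower. *)
Lemma run_tower k env t out s : run env t out -> (rdegree t <= k)%N ->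
    tower k s -> conj_closed s -> {in env, forall x, generated s x} ->
  exists s', [/\ tower k s', conj_closed s' &
    {in out, forall p, generated s' p.1 /\ generated s' p.2}].
Proof.
move=> run_t; elim: run_t s => {env t out}.
- move=> env l /allP env_l s _ tow_s Js Genv; exists s; split=> // _ /mapP[p lp ->] /=.
  by have /andP[p1 p2] := env_l p lp; split; apply: Genv; apply: mem_nth.
- move=> env op a b x y t out Ea Eb _ _ IHt s /= let_k tow_s Js Genv.
  have fG := generated_subfield s; apply: (IHt s) => //.
  have Gx := generated_operand Genv Ea; have Gy := generated_operand Genv Eb.
  apply: generated_rcons => //; case: (op) => /=.
  + exact: (subfieldD fG).
  + exact: (subfieldB fG).
  + exact: (subfieldM fG).
  + exact: (subfield_div fG).
- move=> env a x t out Ea _ IHt s /= let_k tow_s Js Genv; apply: (IHt s) => //.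
  exact: generated_rcons Genv (generated_conj Js (generated_operand Genv Ea)).
- move=> env cs xs z t out Ecs nz_p pz0 _ IHt s /=.
  rewrite geq_max => /andP[cs_k let_k] tow_s Js Genv.
  have [sz_xs Gxs] := generated_operands Genv Ecs.
  set p := Poly xs in nz_p pz0; have sz_p : (size p <= k.+1)%N.
    by apply: leq_trans (size_Poly _) _; rewrite sz_xs; case: (size cs) cs_k.
  have Gp i : generated s p`_i.
    rewrite coef_Poly; have [lti|gei] := ltnP i (size xs); first by apply: Gxs; apply: mem_nth.
    by rewrite nth_default //; exact: (subfield0 (generated_subfield s)).
  have sub1 : {subset s <= rcons s z} by move=> x; rewrite mem_rcons inE orbC => ->.
  have sub2 : {subset rcons s z <= rcons (rcons s z) z^*}.
    by move=> x; rewrite [in X in _ -> X]mem_rcons inE orbC => ->.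
  have sub3 : {subset s <= rcons (rcons s z) z^*} by move=> x /sub1/sub2.
  apply: (IHt (rcons (rcons s z) z^*)) => //.
  + apply: (@tower_rcons _ _ _ (map_poly Num.conj p)).
    * exact: tower_rcons tow_s nz_p sz_p Gp pz0.
    * by rewrite map_poly_eq0.
    * by rewrite size_map_poly.
    * by move=> i; rewrite coef_map; apply: (generated_sub sub1); apply: generated_conj (Gp i).
    * by rewrite fmorph_root.
  + move=> x; rewrite !(mem_rcons, inE) => /or3P[/eqP->|/eqP->|/Js/(generated_sub sub3)//].
      by rewrite conjCK; apply: generated_mem; rewrite !(mem_rcons, inE) eqxx /= orbT.
    by apply: generated_mem; rewrite mem_rcons mem_head.
  apply: generated_rcons => [x env_x|]; first exact: generated_sub sub3 (Genv x env_x).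
  by apply: generated_mem; rewrite !(mem_rcons, inE) eqxx /= orbT.
- move=> env a x t1 t2 out _ _ _ IHt s /=; rewrite geq_max => /andP[let_k _].
  exact: IHt.
move=> env a x t1 t2 out _ _ _ IHt s /=; rewrite geq_max => /andP[_ let_k].
exact: IHt.
Qed.

Lemma run_degree t out y q : run [::] t out -> prime q ->
    (forall s, conj_closed s ->
      {in out, forall p, generated s p.1 /\ generated s p.2} -> generated s y) ->
    (q %| (size (minCpoly y)).-1)%N ->
  (q <= rdegree t)%N.
Proof.
move=> run_t q_pr Gy q_dvd.
have [|//|s [tow_s Js Gout]] := run_tower run_t (leqnn _) (tower_nil _); first by [].
exact: tower_degree tow_s (Gy s Js Gout) q_pr q_dvd.
Qed.

(** * Degrees of algebraic numbers *)

(* With y = 1/t, the hypothesis reads y^q = 4 W(y), where W(y) = y^q F(1/y) is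
   1 modulo y, hence a unit in the ring of algebraic integers. Taking norms,
   N(y)^q = 4^d up to sign, so that q divides 2d. *)
Lemma dvdn_minCpoly_degree (F : {poly int}) (q : nat) (t : algC) :
    odd q -> F \is monic -> size F = q.+1 -> F`_0 = 0 ->
    4 * (map_poly intr F).[t] = 1 ->
  (q %| (size (minCpoly t^-1)).-1)%N.
Proof.
move=> q_odd monF szF F0 Ft; set y := t^-1.
have q_gt0 : (0 < q)%N by case: (q) q_odd.
have t_neq0 : t != 0.
  apply: contra_eq_neq Ft => ->; rewrite horner_coef0 coef_map /= F0 mulr0.
  by rewrite eq_sym oner_eq0.
pose H := \poly_(i < q) F`_(q.-1 - i).
pose W : {poly int} := 1 + 'X * H.
have Fq : F`_q = 1 by move/monicP: monF; rewrite /lead_coef szF.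
have Wrev (z : algC) : z != 0 ->
    z ^+ q * (map_poly intr F).[z^-1] = (map_poly intr W).[z].
  move=> z0; rewrite rmorphD rmorphM rmorph1 /= map_polyX !hornerE.
  have szF' : (size (map_poly (intr : int -> algC) F) <= q.+1)%N by rewrite -szF size_poly.
  rewrite (horner_coef_wide _ szF') big_ord_recr /=.
  rewrite coef_map /= Fq mulrDr rmorph1 mul1r -exprMn divff // expr1n addrC.
  congr (_ + _).
  have szH' : (size (map_poly (intr : int -> algC) H) <= q)%N.
    by rewrite (leq_trans (size_poly _ _)) // size_poly.
  rewrite (horner_coef_wide _ szH').
  rewrite [in RHS](reindex_inj rev_ord_inj) !big_distrr /=; apply: eq_bigr => i _.
  rewrite !coef_map /= /H coef_poly ltn_subrL q_gt0 /=.
  have -> : (q.-1 - (q - i.+1) = i)%N by case: i => i /=; lia.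
  rewrite mulrCA [RHS]mulrCA; congr (_ * _); rewrite -exprS.
  have -> : (q - i.+1).+1 = (q - i)%N by case: i => i /=; lia.
  by rewrite exprVn -expfB ?ltn_ord.
have szH : (size H < q)%N.
  rewrite -(prednK q_gt0) ltnS; apply/leq_sizeP => i lei; rewrite coef_poly.
  case: ifP => // ltiq; have -> : (q.-1 - i = 0)%N by lia.
  by [].
pose P := 'X^q - 4%:R *: W.
have szW : (size W <= q)%N.
  rewrite (leq_trans (size_polyD _ _)) // geq_max size_poly1 q_gt0 /=.
  have [->|H0] := eqVneq H 0; first by rewrite mulr0 size_poly0.
  by rewrite mulrC size_mulX.
have monP : P \is monic.
  rewrite monicE lead_coefDl ?lead_coefXn // size_polyN size_polyXn ltnS.
  exact: leq_trans (size_scale_leq _ _) szW.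
have [r [Dr mon_r] dv_r] := minCpolyP y.
have [zs Dzs] := closed_field_poly_normal (minCpoly y).
have mon_m : minCpoly y \is monic by rewrite Dr map_monic.
rewrite (monicP mon_m) scale1r in Dzs.
have conj_root (p : {poly rat}) z : z \in zs -> root (map_poly ratr p) y -> root (map_poly ratr p) z.
  move=> zs_z; have mz : root (minCpoly y) z by rewrite Dzs root_prod_XsubC.
  rewrite dv_r => /dvdpP[p' ->]; rewrite rmorphM rootM; apply/orP; right.
  by rewrite Dr in mz.
have int_rat (p : {poly int}) : map_poly intr p = map_poly ratr (map_poly intr p) :> {poly algC}.
  by rewrite -map_poly_comp; apply: eq_map_poly => a /=; rewrite ratr_int.
have y_neq0 : y != 0 by rewrite invr_eq0.
have Py (z : algC) : (map_poly intr P).[z] = z ^+ q - 4 * (map_poly intr W).[z].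
  rewrite rmorphB /= map_polyXn map_polyZ /= !hornerE.
  by rewrite rmorph_nat.
have rootPy : root (map_poly intr P) y.
  rewrite /root Py -Wrev // invrK mulrCA Ft mulr1 subrr eqxx //.
have rootPz z : z \in zs -> root (map_poly intr P) z.
  by move=> zs_z; rewrite int_rat conj_root // -int_rat.
have zq z : z \in zs -> z ^+ q = 4 * (map_poly intr W).[z].
  by move/rootPz; rewrite /root Py subr_eq0 => /eqP.
have AintP (z : algC) (p : {poly int}) : z \in Aint -> (map_poly intr p).[z] \in Aint.
  move=> Az; apply: rpred_horner => //.
  by apply/polyOverP => i; rewrite coef_map; apply: Aint_int.
have Az z : z \in zs -> z \in Aint.
  move=> /rootPz /root_monic_Aint; apply; first exact: monic_map.
  by apply/polyOverP => i; rewrite coef_map /= intr_int.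
pose w z : algC := (map_poly intr W).[z]; pose h z : algC := (map_poly intr H).[z].
have wE z : w z = 1 + z * h z by rewrite /w rmorphD rmorphM rmorph1 /= map_polyX !hornerE.
(* An explicit inverse of [w z]. With a = - z h, w = 1 - a, and since q is odd a^q = - z^q h^q = - 4
   w h^q; the geometric sum times w is 1 - a^q = 1 + 4 w h^q. *)
pose s z := \sum_(i < q) (- (z * h z)) ^+ i - 4 * h z ^+ q.
have ws z : z \in zs -> w z * s z = 1.
  move=> zs_z; rewrite /s; set a := - (z * h z).
  have aq : a ^+ q = - (4 * w z * h z ^+ q).
    by rewrite exprNn -signr_odd q_odd expr1 mulN1r exprMn zq.
  have wS : w z * (\sum_(i < q) a ^+ i) = 1 - a ^+ q.
    by rewrite wE -[z * h z]opprK -/a -[1 - a]opprB mulNr -subrX1 opprB.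
  by rewrite mulrBr wS aq; ring.
have As z : z \in zs -> s z \in Aint.
  move=> zs_z; have Ah := AintP _ H (Az _ zs_z).
  apply: rpredB; last by rewrite rpredM ?rpredX ?rpred_nat.
  by apply: rpred_sum => i _; rewrite rpredX // rpredN rpredM // Az.
have szm : (size (minCpoly y)).-1 = size zs by rewrite Dzs size_prod_XsubC.
set d := size zs in szm *; rewrite szm.
pose N := \prod_(z <- zs) z; pose M := \prod_(z <- zs) w z.
have cst (c : algC) : c ^+ d = \prod_(z <- zs) c.
  by rewrite big_const_seq count_predT iter_mulr_1.
have NM : N ^+ q = 4 ^+ d * M.
  by rewrite cst -prodrXl -big_split /= big_seq [RHS]big_seq; apply: eq_bigr.
have intN : N \in Num.int.
  have Aint_y : y \in Aint by apply: Az; rewrite -root_prod_XsubC -Dzs root_minCpoly.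
  have /polyOverP/(_ 0) := Aint_y; rewrite -horner_coef0 Dzs horner_prod.
  have -> : \prod_(z <- zs) ('X - z%:P).[0] = (-1) ^+ d * N :> algC.
    rewrite cst -big_split; apply: eq_bigr => z _ /=.
    by rewrite hornerXsubC sub0r mulN1r.
  by rewrite rpredMsign.
have nz4 : 4 ^+ d != 0 :> algC by rewrite expf_neq0 ?pnatr_eq0.
have ratM : M \in Crat.
  have -> : M = N ^+ q / 4 ^+ d by rewrite NM mulrC mulKf.
  have /intrP[n ->] := intN; apply/CratP; exists (n%:~R ^+ q / 4 ^+ d).
  by rewrite fmorph_div !rmorphXn /= ratr_int !ratr_nat.
have MS : M * \prod_(z <- zs) s z = 1.
  by rewrite -big_split /= big_seq big1.
have intM : M \in Num.int.
  by rewrite Cint_rat_Aint // /M big_seq rpred_prod // => z /Az; apply: AintP.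
have intS : \prod_(z <- zs) s z \in Num.int.
  rewrite Cint_rat_Aint //; last by rewrite big_seq rpred_prod.
  rewrite -(mulr1_eq MS).
  by have /CratP[b ->] := ratM; rewrite -fmorphV Crat_rat.
have M1 : `|M| = 1.
  have := congr1 Num.norm MS; rewrite normrM normr1 => /eqP.
  by rewrite natr_mul_eq1 ?natr_norm_int // => /andP[/eqP].
have /natrP[a Na] := natr_norm_int intN.
have aq : (a ^ q = 2 ^ (2 * d))%N.
  apply/eqP; rewrite -(eqr_nat algC) expnM natrX -Na -normrX NM normrM M1 mulr1.
  by rewrite normrX normr_nat natrX eqxx.
have /(congr1 (logn 2)) := aq; rewrite !lognX (_ : logn 2 2 = 1%N) // muln1 => logn_eq.
have : (q %| 2 * d)%N by rewrite -logn_eq dvdn_mulr.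
by rewrite Gauss_dvdr // coprimen2.
Qed.

(** * Chebyshev polynomials *)

(* The Chebyshev polynomials of the second kind, with the index shifted by one:
   for u = 2 cos(a), [cheb u n] is sin(n a) / sin(a). *)
Fixpoint cheb (R : pzRingType) (u : R) (n : nat) : R :=
  match n with
  | 0 => 0
  | n'.+1 => match n' with
             | 0 => 1
             | n''.+1 => u * cheb u n' - cheb u n''
             end
  end.

Arguments cheb : simpl never.

Lemma cheb0 (R : pzRingType) (u : R) : cheb u 0 = 0.
Proof. by []. Qed.

Lemma cheb1 (R : pzRingType) (u : R) : cheb u 1 = 1.
Proof. by []. Qed.

Lemma chebSS (R : pzRingType) (u : R) n :
  cheb u n.+2 = u * cheb u n.+1 - cheb u n.
Proof. by []. Qed.

Lemma nat_ind2 (P : nat -> Prop) :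
  P 0 -> P 1 -> (forall n, P n -> P n.+1 -> P n.+2) -> forall n, P n.
Proof.
move=> P0 P1 PSS n; suff: P n /\ P n.+1 by case.
by elim: n => [|n [Pn PSn]]; split=> //; apply: PSS.
Qed.

Lemma rmorph_cheb (R S : pzRingType) (f : {rmorphism R -> S}) u n :
  f (cheb u n) = cheb (f u) n.
Proof.
elim/nat_ind2: n => [||n IHn IHSn]; rewrite ?rmorph0 ?rmorph1 //.
by rewrite chebSS rmorphB rmorphM IHn IHSn.
Qed.

Lemma horner_cheb (R : comNzRingType) (u : R) n : (cheb 'X n).[u] = cheb u n.
Proof. by rewrite -[u in RHS]hornerX; apply: (rmorph_cheb (horner_eval u)). Qed.

Section ChebComRing.
Variables (R : comPzRingType) (u : R).

Lemma cheb_quad n :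
  cheb u n.+1 ^+ 2 - u * cheb u n.+1 * cheb u n + cheb u n ^+ 2 = 1.
Proof.
elim: n => [|n IHn]; first by rewrite cheb0 cheb1; ring.
by rewrite -[RHS]IHn chebSS; ring.
Qed.

Lemma cheb_cassini n : cheb u n.+1 ^+ 2 - cheb u n.+2 * cheb u n = 1.
Proof. by rewrite chebSS -[RHS](cheb_quad n); ring. Qed.

Lemma cheb_docagne1 k l :
  cheb u (k + l) * cheb u k.+1 - cheb u l = cheb u (k + l).+1 * cheb u k.
Proof.
elim/nat_ind2: l => [||l IHl IHSl]; first by rewrite addn0 cheb0 subr0 mulrC.
  by rewrite addn1 cheb1 -(cheb_cassini k) chebSS; ring.
rewrite !addnS in IHSl *.
rewrite [cheb u l.+2]chebSS [cheb u (k + l).+3]chebSS.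
rewrite [in RHS]mulrBl -mulrA -IHSl -IHl [cheb u (k + l).+2]chebSS; ring.
Qed.

(** Ptolemy's identity for sines. For fixed [k] and [l] both sides obey the Chebyshev recurrence in
    [i]. It evaluates the determinants of petals below. *)
Lemma cheb_docagne i k l :
  cheb u (k + l) * cheb u (i + k) - cheb u l * cheb u i
    = cheb u (i + k + l) * cheb u k.
Proof.
elim/nat_ind2: i => [||i IHi IHSi].
- by rewrite !add0n cheb0 mulr0 subr0.
- by rewrite !add1n cheb1 mulr1 cheb_docagne1.
rewrite !addSn in IHSi *.
rewrite [cheb u (i + k).+2]chebSS [cheb u i.+2]chebSS [cheb u (i + k + l).+2]chebSS.
by rewrite [RHS]mulrBl -mulrA -IHSi -IHi; ring.
Qed.

(** For u = 2 cos(a), [u ^+ 2 - 2] is 2 cos(2a), and sin(2a) / sin(a) = u. *)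
Lemma cheb_double n : cheb u (2 * n) = u * cheb (u ^+ 2 - 2) n.
Proof.
elim/nat_ind2: n => [||n IHn IHSn].
- by rewrite muln0 !cheb0 mulr0.
- by rewrite muln1 chebSS cheb0 !cheb1; ring.
have -> : (2 * n.+2 = (2 * n).+4)%N by lia.
have e : (2 * n.+1 = (2 * n).+2)%N by lia.
rewrite e in IHSn; rewrite [cheb _ n.+2]chebSS mulrBr mulrCA -IHSn -IHn.
by rewrite !chebSS; ring.
Qed.

End ChebComRing.

Lemma cheb2 (R : comPzRingType) n : cheb (2 : R) n = n%:R.
Proof.
elim/nat_ind2: n => // n IHn IHSn; rewrite chebSS IHn IHSn.
by rewrite -addn2 -[n.+1]addn1 !natrD; ring.
Qed.

Lemma size_chebX (R : nzRingType) n :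
  size (cheb ('X : {poly R}) n) = n /\ (n != 0%N -> cheb ('X : {poly R}) n \is monic).
Proof.
elim/nat_ind2: n => [||n [szn _] [szSn monSn]].
- by rewrite size_poly0.
- by rewrite size_poly1 monic1.
rewrite chebSS.
have szX : size ('X * cheb ('X : {poly R}) n.+1) = n.+2.
  by rewrite -commr_polyX size_mulX ?szSn // -size_poly_eq0 szSn.
have lt_sz : (size (- cheb ('X : {poly R}) n)%R < size ('X * cheb ('X : {poly R}) n.+1)%R)%N.
  by rewrite size_polyN szn szX.
split; first by rewrite size_polyDl.
move=> _; rewrite monicE lead_coefDl // -commr_polyX lead_coefMX.
exact: monSn.
Qed.

(* The product of two consecutive Chebyshev polynomials is odd, hence has no
   constant term. *)
Lemma cheb_degree (t : algC) m :
    4 * (cheb t m.+2 * cheb t m.+1) = 1 ->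
  (m.*2.+1 %| (size (minCpoly t^-1)).-1)%N.
Proof.
move=> tE; pose F : {poly int} := cheb 'X m.+2 * cheb 'X m.+1.
have [sz1 mon1] := size_chebX int m.+1; have [sz2 mon2] := size_chebX int m.+2.
apply: (@dvdn_minCpoly_degree F).
- by rewrite /= odd_double.
- by rewrite monicMl ?mon1 ?mon2.
- by rewrite size_monicM ?mon2 // -?size_poly_eq0 ?sz1 // sz2 -addnn; lia.
- rewrite -horner_coef0 hornerM !horner_cheb.
  have [k [->|->]] : exists k, m.+1 = (2 * k)%N \/ m.+2 = (2 * k)%N.
  + by exists (m.+2)./2; lia.
  + by rewrite cheb_double mul0r mulr0.
  + by rewrite cheb_double !mul0r.
by rewrite rmorphM /= !(rmorph_cheb (map_poly _)) /= map_polyX hornerM !horner_cheb.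
Qed.

(** * Chebyshev values over ordered fields: positivity and monotonicity *)

Section ChebReal.
Variable R : realFieldType.
Implicit Types u : R.

(** The sign cannot change: for consecutive values x >= 1 and y <= 0, the quadratic relation x^2 - u
    x y + y^2 = 1 would have a left side of at least 2. *)
Lemma cheb_ge1_of_sqr u p : 0 < u -> (forall j, (0 < j <= p)%N -> 1 <= cheb u j ^+ 2) ->
  forall j, (0 < j <= p)%N -> 1 <= cheb u j.
Proof.
move=> u_gt0 sq_ge1; elim=> // -[|j] IHj /andP[_ jp] //.
have IH := IHj (ltnW jp); have := sq_ge1 j.+2 jp.
have := cheb_quad u j.+1; move: IH; set x := cheb u j.+1; set y := cheb u j.+2.
move=> x_ge1 quad y2; rewrite leNgt; apply/negP => y_lt1.
have y_le0 : y <= 0.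
  by rewrite leNgt; apply/negP => /ltW y_ge0; rewrite leNgt expr_lt1 // y_lt1 in y2.
have : u * y * x <= 0 by rewrite -mulrA pmulr_rle0 // mulr_le0_ge0 // (le_trans ler01).
have : 1 <= x ^+ 2 by rewrite exprn_ege1.
lra.
Qed.

(** A Sturm comparison: the ratio of consecutive values is [u] minus the inverse of the previous
    ratio, so it increases with [u] as long as the values stay positive. *)
Lemma cheb_ratio u1 u2 n : u1 < u2 -> (forall j, (j <= n)%N -> 0 < cheb u1 j.+1) ->
  [/\ 0 < cheb u2 n.+1, cheb u1 n.+1 <= cheb u2 n.+1
    & cheb u1 n.+2 * cheb u2 n.+1 < cheb u2 n.+2 * cheb u1 n.+1].
Proof.
move=> lt_u; elim: n => [|n IHn] pos; first by rewrite chebSS [cheb u2 2]chebSS !cheb1 !cheb0; split; lra.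
have [|pos2 le12 ratio] := IHn; first by move=> j le_jn; apply/pos/leqW.
have pos1 := pos n (leqW (leqnn n)); have posS := pos n.+1 (leqnn _).
have posS2 : 0 < cheb u2 n.+2.
  by rewrite -(pmulr_lgt0 _ pos1); apply: lt_trans ratio; apply: mulr_gt0.
split=> //.
  rewrite -(ler_pM2r pos1); apply: le_trans (ltW ratio).
  by rewrite ler_wpM2l // ltW.
rewrite [cheb u1 n.+3]chebSS [cheb u2 n.+3]chebSS.
have := mulr_gt0 (mulr_gt0 posS posS2) (_ : 0 < u2 - u1).
by rewrite subr_gt0 => /(_ lt_u); lra.
Qed.

Lemma cheb_lt u1 u2 n : u1 < u2 -> (forall j, (j <= n)%N -> 0 < cheb u1 j.+1) ->
  0 <= cheb u1 n.+2 -> cheb u1 n.+2 < cheb u2 n.+2.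
Proof.
move=> lt_u pos ge0; have [pos2 le12 ratio] := cheb_ratio lt_u pos.
rewrite -(ltr_pM2r (pos n (leqnn n))); apply: le_lt_trans ratio.
by rewrite ler_wpM2l.
Qed.

(** For [u <= 2] a positive sequence is concave, its second difference being (u - 2) times the
    middle value; growth at [j] implies growth all the way from [cheb u 1 = 1]. *)
Lemma cheb_incr u j : u <= 2 -> (forall i, (i <= j)%N -> 0 < cheb u i.+1) ->
  cheb u j.+1 < cheb u j.+2 -> 1 <= cheb u j.+1.
Proof.
move=> u_le2; elim: j => [|j IHj] pos; first by [].
rewrite [cheb u j.+3]chebSS => lt_j.
have lt_j' : cheb u j.+1 < cheb u j.+2.
  by have := pos _ (leqnn _); nra.
apply: le_trans (ltW lt_j'); apply: IHj lt_j' => i le_ij.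
by apply: pos; apply: leqW.
Qed.

Lemma cheb_ge1 u p : u <= 2 -> (forall j, (0 < j <= p)%N -> 0 < cheb u j) ->
  1 <= cheb u p -> forall j, (0 < j <= p)%N -> 1 <= cheb u j.
Proof.
move=> u_le2 pos ge1 j /andP[j_gt0 /subnK].
move: (p - j)%N => k; elim: k j j_gt0 => [|k IHk] j j_gt0 Dp; first by rewrite -Dp in ge1.
have {}IHk : 1 <= cheb u j.+1 by apply: IHk; lia.
case: j j_gt0 Dp IHk => // j _ Dp IHk.
have [|lt_j] := leP (cheb u j.+2) (cheb u j.+1); first exact: le_trans.
by apply: cheb_incr lt_j => // i le_ij; apply: pos; lia.
Qed.

End ChebReal.

(** The root is 2 cos(pi / (n + 2)). The next one lies between it and 2: there the next polynomial
    takes the values [- cheb u n.+1 < 0] and n + 3. *)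
Lemma cheb_root (R : rcfType) n :
  exists u : R, [/\ 0 <= u < 2, cheb u n.+2 = 0 & forall j, (j <= n)%N -> 0 < cheb u j.+1].
Proof.
elim: n => [|n [u [/andP[u_ge0 u_lt2] u_root u_pos]]].
  exists 0; split=> [||j]; first by rewrite lexx ltr0n.
    by rewrite chebSS mul0r cheb0 subrr.
  by rewrite leqn0 => /eqP->; rewrite cheb1 ltr01.
have [|v /andP[uv v2]] := @poly_ivt _ (cheb 'X n.+3) u 2 (ltW u_lt2).
  rewrite !horner_cheb cheb2 ler0n andbT chebSS u_root mulr0 sub0r oppr_le0.
  exact/ltW/u_pos.
rewrite rootE horner_cheb => /eqP v_root.
have u_neq : u != v.
  apply: contra_eq_neq v_root => <-; rewrite chebSS u_root mulr0 sub0r oppr_eq0.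
  by rewrite gt_eqF ?u_pos.
have lt_uv : u < v by rewrite lt_neqAle u_neq.
exists v; split=> // [|j].
  rewrite (le_trans u_ge0) //= lt_neqAle v2 andbT.
  by apply: contra_eq_neq v_root => ->; rewrite cheb2 pnatr_eq0.
rewrite leq_eqVlt => /predU1P[->|le_jn].
  by rewrite -u_root cheb_lt ?u_root.
have [|//] := @cheb_ratio _ u v j lt_uv.
by move=> i le_ij; apply: u_pos; exact: leq_trans le_ij le_jn.
Qed.

(* With u = 2 cos(a), the first equation reads cos(p a) = - cos(a)^2. *)
Lemma exists_angle (R : rcfType) n (p := n.+2) :
  exists u : R, [/\ 0 < u < 2, cheb u p.+1 - cheb u p.-1 = - (u ^+ 2 / 2),
    cheb u p ^+ 2 = 1 + u ^+ 2 / 4 & forall j, (0 < j <= p)%N -> 1 <= cheb u j].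
Proof.
have [u0 [/andP[u0_ge0 u0_lt2] u0_root u0_pos]] := cheb_root R n.
(* [f] vanishes when cos(pa) = - cos(a)^2. It is u0^2 - 4 < 0 at [u0] = 2 cos(pi / p) and 8 at 2, so
   the root found has an angle below pi / p. *)
pose f : {poly R} := 2%:R *: (cheb 'X p.+1 - cheb 'X p.-1) + 'X^2.
have fE x : f.[x] = 2 * (cheb x p.+1 - cheb x p.-1) + x ^+ 2.
  by rewrite hornerD hornerZ hornerD hornerN !horner_cheb hornerXn.
have u0S : cheb u0 n.+1 = 1.
  have := cheb_quad u0 n.+1; rewrite u0_root mulr0 mul0r expr0n subr0 add0r.
  by move/eqP; rewrite sqrp_eq1 ?ltW ?u0_pos // => /eqP.
have fu0 : f.[u0] < 0.
  by rewrite fE /p chebSS /= u0_root u0S; nra.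
have f2 : 0 < f.[2].
  by rewrite fE !cheb2 /p /= -[n.+3]addn2 natrD; lra.
have [|u /andP[u0u u2]] := @poly_ivt _ f u0 2 (ltW u0_lt2).
  by rewrite !ltW.
rewrite rootE => /eqP fu_eq0; exists u.
have u0_lt : u0 < u.
  by rewrite lt_neqAle u0u andbT; apply: contra_eq_neq fu_eq0 => <-; rewrite lt_eqF.
have u_lt2 : u < 2.
  by rewrite lt_neqAle u2 andbT; apply: contra_eq_neq fu_eq0 => ->; rewrite gt_eqF.
have u_gt0 := le_lt_trans u0_ge0 u0_lt.
have D : cheb u p.+1 - cheb u p.-1 = - (u ^+ 2 / 2) by move: fu_eq0; rewrite fE; lra.
have pos j : (0 < j <= p)%N -> 0 < cheb u j.
  case: j => // j /andP[_]; rewrite ltnS leq_eqVlt => /predU1P[->|le_jn].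
    by rewrite -u0_root cheb_lt ?u0_root.
  have [|//] := @cheb_ratio _ u0 u j u0_lt.
  by move=> i le_ij; apply: u0_pos; exact: leq_trans le_ij le_jn.
(* sin(pa)^2 = 1 - cos(a)^4 = sin(a)^2 (1 + cos(a)^2); the factor [u ^+ 2 - 4] to be cancelled is -
   4 sin(a)^2. *)
have sq : cheb u p ^+ 2 = 1 + u ^+ 2 / 4.
  have q := cheb_quad u n.+1.
  move: D; rewrite /p [cheb u n.+3]chebSS /= => D.
  have nz : u ^+ 2 - 4 != 0 by rewrite lt_eqF //; nra.
  apply: (mulfI nz); set a := cheb u n.+2 in q D *; set b := cheb u n.+1 in q D *.
  have {D}Db : b = (u * a + u ^+ 2 / 2) / 2 by lra.
  by move: q; rewrite Db => q; apply/eqP; rewrite -subr_eq0; apply/eqP; lra.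
split=> //; first by rewrite u_gt0.
have pgt : 0 < cheb u p by apply: pos; rewrite /p leqnn.
apply: cheb_ge1 (ltW u_lt2) pos _; rewrite -(ler_pXn2r (_ : 0 < 2)%N) ?nnegrE ?ler01 ?(ltW pgt) // expr1n sq.
by rewrite lerDl mulr_ge0 ?sqr_ge0 // invr_ge0 ler0n.
Qed.

Lemma cheb_addS (R : comPzRingType) (u : R) m n :
  cheb u (m + n).+1 = cheb u m.+1 * cheb u n.+1 - cheb u m * cheb u n.
Proof.
elim/nat_ind2: m => [||m IHm IHSm].
- by rewrite cheb0 cheb1 mul1r mul0r subr0.
- by rewrite !chebSS !cheb1 !cheb0; ring.
rewrite !addSn in IHSm *; rewrite [cheb u (m + n).+3]chebSS IHSm IHm.
by rewrite [cheb u m.+3]chebSS [cheb u m.+2]chebSS; ring.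
Qed.

Lemma cheb_add (R : comPzRingType) (u : R) m n :
  cheb u (m + n) = cheb u m.+1 * cheb u n + cheb u m * cheb u n.+1 - u * cheb u m * cheb u n.
Proof.
elim/nat_ind2: m => [||m IHm IHSm].
- by rewrite cheb0 cheb1; ring.
- by rewrite !chebSS !cheb1 !cheb0; ring.
rewrite !addSn in IHSm *; rewrite [cheb u (m + n).+2]chebSS IHSm IHm.
by rewrite [cheb u m.+3]chebSS [cheb u m.+2]chebSS; ring.
Qed.

(* The law of cosines: sin^2 a + sin^2 b + 2 cos(a+b) sin a sin b = sin^2(a+b). *)
Lemma cheb_cosine_law (R : comPzRingType) (u : R) m n :
  cheb u m ^+ 2 + cheb u n ^+ 2
    + (2 * cheb u (m + n).+1 - u * cheb u (m + n)) * cheb u m * cheb u n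
  = cheb u (m + n) ^+ 2.
Proof.
have := cheb_quad u m; have := cheb_quad u n; rewrite cheb_addS cheb_add.
set x := cheb u m; set y := cheb u n; set x1 := cheb u m.+1; set y1 := cheb u n.+1.
move=> qn qm; have -> : x ^+ 2 + y ^+ 2 = x ^+ 2 * (y1 ^+ 2 - u * y1 * y + y ^+ 2)
    + y ^+ 2 * (x1 ^+ 2 - u * x1 * x + x ^+ 2) by rewrite qn qm !mulr1.
ring.
Qed.

(* A disc with curvature b and center w / b is encoded by (Re w, Im w, b, c),
   where c is the curvature of its image under inversion in the unit circle;
   the vectors of discs and half-planes are those with [lprod v v = 1], tangent
   discs have product -1 and disjoint discs have product less than -1. *)
Record lvec (R : Type) := LVec { vx : R; vy : R; vb : R; vc : R }.

Definition lprod (R : fieldType) (v w : lvec R) : R :=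
  vx v * vx w + vy v * vy w - (vb v * vc w + vb w * vc v) / 2.

(* Inversion centered at (px, py). *)
Definition linv (R : fieldType) (px py : R) (v : lvec R) : lvec R :=
  LVec (vx v - vb v * px) (vy v - vb v * py)
    (vb v * (px ^+ 2 + py ^+ 2) - 2 * (vx v * px + vy v * py) + vc v) (vb v).

Lemma lprod_linv (R : numFieldType) (px py : R) v w :
  lprod (linv px py v) (linv px py w) = lprod v w.
Proof. by case: v w => x y b c [x' y' b' c']; rewrite /lprod /linv /=; field. Qed.

Lemma lprodC (R : fieldType) (v w : lvec R) : lprod v w = lprod w v.
Proof. by rewrite /lprod addrC [vx w * _]mulrC [vy w * _]mulrC [X in _ - X / _]addrC; ring. Qed.

(** The squared distance of two centers differs from (r + r')^2 by - 2 r r' (1 + [lprod]), so the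
    comparison of [lprod] with -1 decides disjointness and tangency. *)
Lemma circle_packing_of_lvec n (e : rel 'I_n) (v : 'I_n -> lvec algR) :
    (forall i, 0 < vb (v i)) -> (forall i, lprod (v i) (v i) = 1) ->
    (forall i j, i != j -> lprod (v i) (v j) <= -1) ->
    (forall i j, e i j -> lprod (v i) (v j) = -1) ->
  exists cs rs : 'I_n -> algC, circle_packing e cs rs.
Proof.
move=> b_gt0 v_norm v_disj v_edge.
pose X i := vx (v i) / vb (v i); pose Y i := vy (v i) / vb (v i); pose r i := (vb (v i))^-1.
have r_gt0 i : 0 < r i by rewrite invr_gt0.
have dist i j : (X i - X j) ^+ 2 + (Y i - Y j) ^+ 2
    = (r i + r j) ^+ 2 - 2 * r i * r j * (1 + lprod (v i) (v j)).
  have := v_norm i; have := v_norm j; have := lt0r_neq0 (b_gt0 i); have := lt0r_neq0 (b_gt0 j).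
  rewrite /lprod /X /Y /r; case: (v i) (v j) => x y b c [x' y' b' c'] /= nzb' nzb.
  move=> nj ni.
  have -> : c = (x ^+ 2 + y ^+ 2 - 1) / b.
    by apply: (mulIf nzb); rewrite divfK //; lra.
  have -> : c' = (x' ^+ 2 + y' ^+ 2 - 1) / b'.
    by apply: (mulIf nzb'); rewrite divfK //; lra.
  by field; rewrite nzb nzb'.
pose cs i : algC := algRval (X i) + 'i * algRval (Y i).
have dist2 i j : `|cs i - cs j| ^+ 2 = algRval ((X i - X j) ^+ 2 + (Y i - Y j) ^+ 2).
  have -> : cs i - cs j = algRval (X i - X j) + 'i * algRval (Y i - Y j).
    by rewrite /cs !rmorphB /=; ring.
  by rewrite normC2_rect ?algRvalP // rmorphD !rmorphXn.
have sum_ge0 i j : 0 <= r i + r j by rewrite addr_ge0 ?ltW.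
have cmp2 (a b : algC) : 0 <= a -> 0 <= b -> (a <= b) = (a ^+ 2 <= b ^+ 2).
  by move=> a0 b0; rewrite ler_pXn2r.
have sumE i j : algRval (r i) + algRval (r j) = algRval (r i + r j) by [].
have sqrE (a : algR) : algRval a ^+ 2 = algRval (a ^+ 2) by [].
exists cs, (fun i => algRval (r i)); split; [exact: r_gt0 | split=> i j].
  move=> /v_disj le_ij; rewrite sumE cmp2 ?normr_ge0 //; last exact: sum_ge0.
  rewrite dist2 dist sqrE.
  suff : (r i + r j) ^+ 2 <= (r i + r j) ^+ 2 - 2 * r i * r j * (1 + lprod (v i) (v j)) by [].
  rewrite lerDl oppr_ge0 mulr_ge0_le0 //; last by lra.
  by rewrite !mulr_ge0 ?ltW ?ltr0n.
move=> /v_edge eq_ij; apply/eqP; rewrite sumE -(@eqrXn2 _ 2) ?normr_ge0 //.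
  by rewrite dist2 dist eq_ij subrr mulr0 subr0 sqrE.
exact: sum_ge0.
Qed.

(** * The graph and its packing *)

(* The hub 2p is surrounded by the ring of petals 0, ..., 2p-1. Vertex 2p+1
   touches the petals from 0 to p, vertex 2p+2 touches the petals from p round
   to 0, and vertex 2p+3 touches these two vertices and the petals 0 and p. *)
Definition wheel_arc (p i j : nat) : bool :=
  [|| (j == i.+1) && (j < p.*2), (i == 0) && (j == p.*2.-1),
      (i < p.*2) && (j == p.*2), (i <= p) && (j == p.*2.+1),
      ((p <= i < p.*2) || (i == 0)) && (j == p.*2.+2)
    | (i \in [:: 0; p; p.*2.+1; p.*2.+2]) && (j == p.*2.+3)]%N.

Definition double_wheel (p : nat) : rel 'I_(p.*2.+4) :=
  fun i j => wheel_arc p i j || wheel_arc p j i.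

Lemma wheel_arc_ltn p i j : (1 < p)%N -> wheel_arc p i j -> (i < j)%N.
Proof. by rewrite /wheel_arc !inE => p_gt1; lia. Qed.

Lemma double_wheel_simple p : (1 < p)%N -> simple_graph (@double_wheel p).
Proof.
move=> p_gt1; split=> [i|i j]; last by rewrite /double_wheel orbC.
by rewrite /double_wheel orbb; apply/negP => /(wheel_arc_ltn p_gt1); rewrite ltnn.
Qed.

(* The disc of radius 1 / (2 t^2) tangent to the real axis at s / t. *)
Definition petal (R : fieldType) (s t : R) : lvec R :=
  LVec (2 * s * t) 1 (2 * t ^+ 2) (2 * s ^+ 2).

(** As for Ford circles, tangency of two petals amounts to a determinant of 1 or -1. *)
Lemma lprod_petal (R : numFieldType) (s t s' t' : R) :
  lprod (petal s t) (petal s' t') = 1 - 2 * (s * t' - s' * t) ^+ 2.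
Proof. by rewrite /lprod /=; field. Qed.

(** * An explicit configuration, with the hub and petal 0 as half-planes *)

Section Configuration.
Variables (R : realFieldType) (u : R) (n : nat).
Let p := n.+2.
Let g := cheb u p.
Let h := g ^+ 2 - 1.
Ltac nlia := try clear dependent R; lia.
Hypotheses (u_gt0 : 0 < u) (u_lt2 : u < 2).
Hypothesis cos_eq : cheb u p.+1 - cheb u p.-1 = - (u ^+ 2 / 2).
Hypothesis sin_eq : g ^+ 2 = 1 + u ^+ 2 / 4.
Hypothesis cheb_ge1 : forall j, (0 < j <= p)%N -> 1 <= cheb u j.

(** The point where petal 1 touches the real axis, the rightmost such point among the petals. *)
Let rho := cheb u p.-1 / g.

(* The hub is the lower half-plane, petal 0 the half-plane above Im z = 1 and
   petal p is tangent to the hub at 0; the figure is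
   symmetric under x -> -x, and the caps and the top disc are then determined
   by tangency, using u^2 = 4 h. *)
Definition conf (i : nat) : lvec R :=
  if (i <= p)%N then petal (cheb u (p - i) / g) (cheb u i)
  else if (i < p.*2)%N then petal (- (cheb u (i - p) / g)) (cheb u (p.*2 - i))
  else if i == p.*2 then LVec 0 (-1) 0 0
  else if i == p.*2.+1 then LVec (2 / g) (2 / h - 1) (2 / h) (2 / (h * g ^+ 2))
  else if i == p.*2.+2 then LVec (- (2 / g)) (2 / h - 1) (2 / h) (2 / (h * g ^+ 2))
  else LVec 0 ((g ^+ 2 + 1) / h) (2 * g ^+ 2 / h) (2 / h).

Let g_ge1 : 1 <= g. Proof. by apply: cheb_ge1; rewrite leqnn. Qed.
Let g_gt0 : 0 < g. Proof. exact: lt_le_trans ltr01 g_ge1. Qed.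
Let g_neq0 : g != 0. Proof. exact: lt0r_neq0. Qed.
Let hE : h = u ^+ 2 / 4. Proof. by rewrite /h sin_eq addrC addKr. Qed.
Let h_gt0 : 0 < h. Proof. by rewrite hE divr_gt0 ?exprn_gt0 ?ltr0n. Qed.
Let h_lt1 : h < 1.
Proof. by rewrite hE ltr_pdivrMr ?ltr0n // mul1r; move: u_gt0 u_lt2; nra. Qed.
Let h_neq0 : h != 0. Proof. exact: lt0r_neq0. Qed.

Let cheb_ge0 j : (j <= p)%N -> 0 <= cheb u j.
Proof. by case: j => [|j] jp; rewrite ?cheb0 // (le_trans ler01) ?cheb_ge1. Qed.

(** Describes a petal of the right half; those of the left half are mirror images. The equation is
    tangency to the first cap, and the last clause serves to keep the center of inversion outside
    the petal. *)
Definition pos_petal (s t : R) : Prop :=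
  [/\ 0 <= s, 0 <= t, s ^+ 2 + t ^+ 2 / g ^+ 2 = 1 + 2 * h / g * s * t
    & t = 0 \/ 1 <= t /\ s <= rho * t].

(** The equation is the law of cosines for the angles ja and (p - j)a, whose sum pa has cosine -
    cos(a)^2 = - h. *)
Lemma pos_petal_cheb j : (j <= p)%N -> pos_petal (cheb u (p - j) / g) (cheb u j).
Proof.
move=> jp; split; first by rewrite divr_ge0 ?cheb_ge0 ?leq_subr // ltW.
- exact: cheb_ge0.
- have := cheb_cosine_law u (p - j) j; rewrite subnK //.
  have -> : 2 * cheb u p.+1 - u * cheb u p = - (2 * h).
    by move: cos_eq; rewrite hE /p chebSS /=; lra.
  rewrite -/g => law; apply: (mulIf (expf_neq0 2 g_neq0)).
  have -> : (cheb u (p - j) / g) ^+ 2 + cheb u j ^+ 2 / g ^+ 2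
     = (cheb u (p - j) ^+ 2 + cheb u j ^+ 2) / g ^+ 2 by field.
  rewrite divfK ?expf_neq0 //.
  have -> : (1 + 2 * h / g * (cheb u (p - j) / g) * cheb u j) * g ^+ 2
     = g ^+ 2 + 2 * h * cheb u (p - j) * cheb u j by field.
  by rewrite -law; ring.
case: j jp => [|j] jp; [by left | right; split; first exact: cheb_ge1].
rewrite /rho mulrAC ler_pM2r ?invr_gt0 // -subr_ge0.
have := cheb_docagne1 u j (p - j.+1); have -> : (j + (p - j.+1) = p.-1)%N by nlia.
by move=> ->; rewrite mulr_ge0 ?cheb_ge0 // ltnW.
Qed.

Lemma conf_petal i : (i < p.*2)%N -> exists s t,
  [/\ pos_petal s t, conf i = petal (if (i <= p)%N then s else - s) t
    & i \in [:: 0%N; p] -> s * t = 0].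
Proof.
rewrite /conf => ip2; rewrite ip2; case: (leqP i p) => ip.
  exists (cheb u (p - i) / g), (cheb u i); split=> //; first exact: pos_petal_cheb.
  rewrite !inE => /pred2P[]->; rewrite ?cheb0 ?mulr0 //.
  by rewrite subnn cheb0 mul0r mul0r.
exists (cheb u (i - p) / g), (cheb u (p.*2 - i)); split=> //; last first.
  by rewrite !inE => /pred2P[] Di; move: ip; rewrite Di ?ltnn.
have -> : (i - p = p - (p.*2 - i))%N by nlia.
by apply: pos_petal_cheb; nlia.
Qed.

(** By d'Ocagne the determinant is [cheb u (j - i)] up to sign, wherever the pair sits in the
    chain. *)
Lemma lprod_run i j : (i < j <= p)%N ->
  lprod (petal (cheb u (p - i) / g) (cheb u i)) (petal (cheb u (p - j) / g) (cheb u j))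
    = 1 - 2 * cheb u (j - i) ^+ 2.
Proof.
move=> /andP[ij jp]; rewrite lprod_petal.
have := cheb_docagne u i (j - i) (p - j).
have -> : (j - i + (p - j) = p - i)%N by nlia.
have -> : (i + (j - i) = j)%N by nlia.
rewrite subnKC // -/g => docagne.
suff -> : cheb u (p - i) / g * cheb u j - cheb u (p - j) / g * cheb u i = cheb u (j - i) by [].
by rewrite mulrAC [X in _ - X]mulrAC -mulrBl docagne mulrC mulKf.
Qed.

Lemma lprod_reflect (s t s' t' : R) :
  lprod (petal (- s) t) (petal (- s') t') = lprod (petal s t) (petal s' t').
Proof. by rewrite !lprod_petal; ring. Qed.

Let one_sub_le (x : R) : 1 <= x ^+ 2 -> 1 - 2 * x ^+ 2 <= -1.
Proof. by lra. Qed.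

Let sqr_ge1 (x : R) : 1 <= x -> 1 <= x ^+ 2.
Proof. by move=> x_ge1; rewrite exprn_ege1. Qed.

(* sin(i a) sin((p-j) a) + sin((p-i) a) sin(j a) >= sin(p a) sin(a) *)
Lemma cheb_cross i j : (0 < i < p)%N -> (0 < j < p)%N ->
  g <= cheb u (p - i) * cheb u j + cheb u (p - j) * cheb u i.
Proof.
wlog ij : i j / (i <= j)%N => [hw i_p j_p|/andP[i_gt0 ip] /andP[j_gt0 jp]].
  have [/hw|/ltnW/hw] := leqP i j; first exact.
  by rewrite addrC; apply.
(* For [i < j] the first product alone reaches [g], by d'Ocagne; for [i = j] the addition formula
   and [u < 2] give the bound. *)
move: ij; rewrite leq_eqVlt => /predU1P[<-|ij]; last first.
  have := cheb_docagne u i (j - i) (p - j).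
  have -> : (j - i + (p - j) = p - i)%N by nlia.
  have -> : (i + (j - i) = j)%N by nlia.
  rewrite subnKC 1?ltnW // -/g => /eqP; rewrite subr_eq => /eqP->.
  have : 1 <= cheb u (j - i) by apply: cheb_ge1; nlia.
  have : 0 <= cheb u (p - j) * cheb u i by rewrite mulr_ge0 ?cheb_ge0 //; nlia.
  by have := g_gt0; nra.
have := cheb_addS u i (p - i).-1; rewrite prednK ?subn_gt0 //.
have -> : (i + (p - i).-1).+1 = p by nlia.
case: i i_gt0 ip => // i _ ip; rewrite -/g chebSS => ->.
have : 0 <= cheb u i.+1 * cheb u (p - i.+1).-1 by rewrite mulr_ge0 ?cheb_ge0 //; nlia.
have : 0 <= cheb u i * cheb u (p - i.+1) by rewrite mulr_ge0 ?cheb_ge0 //; nlia.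
have : 0 <= (2 - u) * (cheb u i.+1 * cheb u (p - i.+1)).
  by rewrite !mulr_ge0 ?cheb_ge0 ?subr_ge0 ?(ltW u_lt2) //; nlia.
lra.
Qed.
Lemma conf_hub : conf p.*2 = LVec 0 (-1) 0 0.
Proof. by rewrite /conf ltnn eqxx ifF //; nlia. Qed.

Lemma conf_cap1 : conf p.*2.+1 = LVec (2 / g) (2 / h - 1) (2 / h) (2 / (h * g ^+ 2)).
Proof. by rewrite /conf eqxx !ifF //; nlia. Qed.

Lemma conf_cap2 : conf p.*2.+2 = LVec (- (2 / g)) (2 / h - 1) (2 / h) (2 / (h * g ^+ 2)).
Proof. by rewrite /conf eqxx !ifF //; nlia. Qed.

Lemma conf_top : conf p.*2.+3 = LVec 0 ((g ^+ 2 + 1) / h) (2 * g ^+ 2 / h) (2 / h).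
Proof. by rewrite /conf !ifF //; nlia. Qed.

Lemma conf_low j : (0 < j <= p)%N ->
  conf (p.*2 - j) = petal (- (cheb u (p - j) / g)) (cheb u j).
Proof.
move=> /andP[j_gt0 jp]; rewrite /conf.
have -> : (p.*2 - j - p = p - j)%N by nlia.
have -> : (p.*2 - (p.*2 - j) = j)%N by nlia.
case: ifP => [pj|_]; last by rewrite ifT //; nlia.
have -> : j = p by nlia.
have -> : (p.*2 - p = p)%N by nlia.
by rewrite subnn cheb0 mul0r oppr0.
Qed.

Lemma conf_up j : (j <= p)%N -> conf j = petal (cheb u (p - j) / g) (cheb u j).
Proof. by rewrite /conf => ->. Qed.

(** Two petals of the same half form a run; petal p belongs to both halves, and so does petal 0,
    which is its own mirror image. Petals strictly inside opposite halves are kept apart by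
    [cheb_cross] and are never adjacent. *)
Lemma lprod_conf_petals i j : (i < j < p.*2)%N ->
  lprod (conf i) (conf j) <= -1 /\ (wheel_arc p i j -> lprod (conf i) (conf j) = -1).
Proof.
have run_le k : (0 < k <= p)%N -> 1 - 2 * cheb u k ^+ 2 <= -1.
  by move=> kp; apply/one_sub_le/sqr_ge1/cheb_ge1.
have run_eq : 1 - 2 * cheb u 1 ^+ 2 = -1 by rewrite cheb1; lra.
move=> /andP[ij jp2]; have [jp|pj] := leqP j p.
  rewrite !conf_up ?(ltnW (leq_trans ij jp)) // lprod_run ?ij //.
  split; first by apply: run_le; nlia.
  by rewrite /wheel_arc !inE => arc_ij; have -> : (j - i = 1)%N by nlia.
have Cl k : (p <= k < p.*2)%N ->
    conf k = petal (- (cheb u (p - (p.*2 - k)) / g)) (cheb u (p.*2 - k)).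
  move=> /andP[pk k2p]; have {1}-> : k = (p.*2 - (p.*2 - k))%N by nlia.
  by apply: conf_low; nlia.
have j'p : (0 < p.*2 - j < p)%N by nlia.
rewrite [conf j]Cl ?jp2 ?(ltnW pj) //.
have [pi|ip] := leqP p i.
  rewrite Cl ?pi ?(ltn_trans ij) //.
  rewrite lprod_reflect lprodC lprod_run; last nlia.
  split; first by apply: run_le; nlia.
  by rewrite /wheel_arc !inE => arc_ij; have -> : (p.*2 - i - (p.*2 - j) = 1)%N by nlia.
move: j'p; have j'E : (wheel_arc p i j -> i = 0%N -> p.*2 - j = 1)%N.
  by rewrite /wheel_arc !inE; nlia.
have j'E0 : (0 < i -> wheel_arc p i j = false)%N by rewrite /wheel_arc !inE; nlia.
rewrite conf_up; last exact: ltnW.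
move: (p.*2 - j)%N j'E => j' j'E j'p.
have [i0|i_gt0] := posnP i.
  rewrite i0 in j'E *.
  have -> : lprod (petal (cheb u (p - 0) / g) (cheb u 0))
     (petal (- (cheb u (p - j') / g)) (cheb u j')) =
     lprod (petal (cheb u (p - 0) / g) (cheb u 0)) (petal (cheb u (p - j') / g) (cheb u j')).
    by rewrite !lprod_petal cheb0; ring.
  rewrite lprod_run; last nlia.
  rewrite subn0; split; first by apply: run_le; nlia.
  by move=> arc_ij; rewrite j'E.
split; last by rewrite j'E0.
rewrite lprod_petal; apply/one_sub_le/sqr_ge1.
rewrite mulNr opprK mulrAC [X in _ + X]mulrAC -mulrDl ler_pdivlMr // mul1r.
by apply: cheb_cross; nlia.
Qed.

Lemma lprod_cap1 s t : pos_petal s t ->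
  lprod (petal s t) (conf p.*2.+1) = -1.
Proof.
case=> _ _ q _; rewrite conf_cap1 /lprod /=.
have -> : 2 * s * t * (2 / g) + 1 * (2 / h - 1)
    - (2 * t ^+ 2 * (2 / (h * g ^+ 2)) + 2 / h * (2 * s ^+ 2)) / 2
  = 4 * s * t / g + 2 / h - 1 - 2 / h * (s ^+ 2 + t ^+ 2 / g ^+ 2) by field; rewrite g_neq0.
by rewrite q; field; rewrite g_neq0.
Qed.

(** The excess 8 s t / g vanishes exactly for s t = 0, as for petals 0 and p, which touch both
    caps. *)
Lemma lprod_cap1N s t : pos_petal s t ->
  lprod (petal (- s) t) (conf p.*2.+1) = -1 - 8 * (s * t) / g.
Proof.
move=> /lprod_cap1 => <-; rewrite conf_cap1 /lprod /=.
by field; rewrite h_neq0 g_neq0.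
Qed.

Lemma lprod_cap2 s t : lprod (petal s t) (conf p.*2.+2) = lprod (petal (- s) t) (conf p.*2.+1).
Proof. by rewrite conf_cap1 conf_cap2 /lprod /=; ring. Qed.

Lemma lprod_top s t : pos_petal s t ->
  lprod (petal s t) (conf p.*2.+3) = -1 - 4 * g * (s * t).
Proof.
case=> _ _ q _; rewrite conf_top /lprod /=.
have -> : 2 * s * t * 0 + 1 * ((g ^+ 2 + 1) / h)
    - (2 * t ^+ 2 * (2 / h) + 2 * g ^+ 2 / h * (2 * s ^+ 2)) / 2
  = (g ^+ 2 + 1) / h - 2 * g ^+ 2 / h * (s ^+ 2 + t ^+ 2 / g ^+ 2).
  by field; rewrite h_neq0 g_neq0.
have -> : (g ^+ 2 + 1) / h - 2 * g ^+ 2 / h * (s ^+ 2 + t ^+ 2 / g ^+ 2)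
    = (g ^+ 2 + 1) / h - 2 * g ^+ 2 / h - 4 * g * (s * t).
  by rewrite q; field; rewrite h_neq0 g_neq0.
have gE : g ^+ 2 = h + 1 by rewrite /h subrK.
by congr (_ - _); rewrite gE; field.
Qed.

Lemma lprod_topN s t : lprod (petal (- s) t) (conf p.*2.+3) = lprod (petal s t) (conf p.*2.+3).
Proof. by rewrite conf_top /lprod /=; ring. Qed.

Lemma lprod_hub s t : lprod (petal s t) (conf p.*2) = -1.
Proof. by rewrite conf_hub /lprod /=; ring. Qed.

Lemma conf_norm i : lprod (conf i) (conf i) = 1.
Proof.
rewrite /conf; case: ifP => _; first by rewrite lprod_petal; ring.
case: ifP => _; first by rewrite lprod_petal; ring.
have gE : g ^+ 2 = h + 1 by rewrite /h subrK.
have nz : h + 1 != 0 by rewrite -gE expf_neq0.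
case: ifP => _; first by rewrite /lprod /=; ring.
case: ifP => _.
  by rewrite /lprod /= -expr2 exprMn exprVn gE; field; rewrite h_neq0 nz.
case: ifP => _.
  by rewrite /lprod /= -expr2 sqrrN exprMn exprVn gE; field; rewrite h_neq0 nz.
by rewrite /lprod /= gE; field.
Qed.

Lemma lprod_conf i j : (i < j < p.*2.+4)%N ->
  lprod (conf i) (conf j) <= -1 /\ (wheel_arc p i j -> lprod (conf i) (conf j) = -1).
Proof.
have inv2h : 1 <= h^-1 by rewrite invf_ge1 // ltW.
have st_ge0 s t : pos_petal s t -> 0 <= s * t by case=> s0 t0 _ _; apply: mulr_ge0.
move=> /andP[ij j_lt]; have [jp2|p2j] := ltnP j p.*2.
  by apply: lprod_conf_petals; rewrite ij.
have [j0|[j1|[j2|j3]]] : j = p.*2 \/ j = p.*2.+1 \/ j = p.*2.+2 \/ j = p.*2.+3 by nlia.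
- rewrite j0 in ij *; have [s [t [_ -> _]]] := conf_petal ij.
  by rewrite lprod_hub.
- rewrite j1 in ij *; have [ip2|p2i] := ltnP i p.*2.
    have [s [t [st -> _]]] := conf_petal ip2; case: (leqP i p) => ip.
      by rewrite lprod_cap1.
    rewrite lprod_cap1N //; split; last by rewrite /wheel_arc !inE => arc_ij; exfalso; nlia.
    by rewrite gerDl oppr_le0 divr_ge0 ?(ltW g_gt0) // mulr_ge0 ?(st_ge0 _ _ st).
  have -> : i = p.*2 by nlia.
  split; last by rewrite /wheel_arc !inE => arc_ij; exfalso; nlia.
  by rewrite conf_hub conf_cap1 /lprod /=; lra.
- rewrite j2 in ij *; have [ip2|p2i] := ltnP i p.*2.
    have [s [t [st -> st0]]] := conf_petal ip2; case: (leqP i p) => ip.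
      rewrite lprod_cap2 lprod_cap1N //; split.
        by rewrite gerDl oppr_le0 divr_ge0 ?(ltW g_gt0) // mulr_ge0 ?(st_ge0 _ _ st).
      move=> arc_ij; rewrite st0 ?mulr0 ?mul0r ?subr0 //.
      by move: arc_ij; rewrite /wheel_arc !inE; nlia.
    by rewrite lprod_cap2 opprK lprod_cap1.
  have [->|->] : i = p.*2 \/ i = p.*2.+1 by nlia.
    split; last by rewrite /wheel_arc !inE => arc_ij; exfalso; nlia.
    by rewrite conf_hub conf_cap2 /lprod /=; lra.
  split; last by rewrite /wheel_arc !inE => arc_ij; exfalso; nlia.
  rewrite conf_cap1 conf_cap2.
  have -> : lprod (LVec (2 / g) (2 / h - 1) (2 / h) (2 / (h * g ^+ 2)))
      (LVec (- (2 / g)) (2 / h - 1) (2 / h) (2 / (h * g ^+ 2))) = - (8 / g ^+ 2) +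
     lprod (LVec (2 / g) (2 / h - 1) (2 / h) (2 / (h * g ^+ 2)))
      (LVec (2 / g) (2 / h - 1) (2 / h) (2 / (h * g ^+ 2))).
    by rewrite /lprod /=; field; rewrite g_neq0.
  rewrite -conf_cap1 conf_norm.
  (* The caps are disjoint because g^2 = 1 + h < 2. *)
  have : 4 <= 8 / g ^+ 2 by rewrite ler_pdivlMr ?exprn_gt0 //; move: h_lt1; rewrite /h; lra.
  lra.
rewrite j3 in ij *; have [ip2|p2i] := ltnP i p.*2.
  have [s [t [st -> st0]]] := conf_petal ip2.
  have -> : lprod (petal (if (i <= p)%N then s else - s) t) (conf p.*2.+3) = -1 - 4 * g * (s * t).
    by case: ifP => _; rewrite ?lprod_topN lprod_top.
  split; first by rewrite gerDl oppr_le0 mulr_ge0 ?(st_ge0 _ _ st) // mulr_ge0 // ltW.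
  move=> arc_ij; rewrite st0 ?mulr0 ?subr0 //.
  by move: arc_ij; rewrite /wheel_arc !inE; nlia.
have gE : g ^+ 2 = h + 1 by rewrite /h subrK.
have [->|i12] : i = p.*2 \/ (i = p.*2.+1 \/ i = p.*2.+2) by nlia.
  split; last by rewrite /wheel_arc !inE => arc_ij; exfalso; nlia.
  have -> : lprod (conf p.*2) (conf p.*2.+3) = -1 - 2 * h^-1.
    by rewrite conf_hub conf_top /lprod /= gE; field.
  by lra.
suff -> : lprod (conf i) (conf p.*2.+3) = -1 by [].
by case: i12 => ->; rewrite ?conf_cap1 ?conf_cap2 conf_top /lprod /= gE; field; rewrite -?gE ?expf_neq0 ?h_neq0.
Qed.

(* The center of inversion lies in the interstice of the hub and the petals 0
   and 1, hence the images of all discs and half-planes are bounded discs. *)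
Lemma conf_vb_gt0 i : (i < p.*2.+4)%N -> 0 < vb (linv (rho + 1) (2^-1) (conf i)).
Proof.
have u0 := u_gt0; have h0 := h_gt0.
have rho_ge0 : 0 <= rho by rewrite divr_ge0 ?cheb_ge0 ?(ltW g_gt0).
have rhoE : rho = u / 2 + h / g.
  rewrite /rho; apply: (mulIf g_neq0); rewrite divfK // mulrDl divfK //.
  by move: cos_eq; rewrite hE /p chebSS /= -/g; lra.
have gE : g ^+ 2 = h + 1 by rewrite /h subrK.
have cap_gt0 : 0 < vb (linv (rho + 1) 2^-1 (conf p.*2.+1)).
  rewrite conf_cap1 /linv /=.
  have -> : 2 / h * ((rho + 1) ^+ 2 + 2^-1 ^+ 2) - 2 * (2 / g * (rho + 1) + (2 / h - 1) * 2^-1)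
    + 2 / (h * g ^+ 2) = 2 / h * ((u / 2 + 1) ^+ 2 - 3 / 4 + h / 2 + (1 - h ^+ 2) / g ^+ 2).
    by rewrite rhoE; field; rewrite h_neq0 g_neq0.
  have -> : (1 - h ^+ 2) / g ^+ 2 = 1 - h by rewrite gE; field; rewrite -gE expf_neq0.
  rewrite mulr_gt0 ?divr_gt0 //; have := hE; lra.
move=> ip; have [ip2|p2i] := ltnP i p.*2.
  have [s [t [[s_ge0 t_ge0 q st] -> _]]] := conf_petal ip2.
  suff : forall s', s' = s \/ s' = - s -> 0 < vb (linv (rho + 1) 2^-1 (petal s' t)).
    by apply; case: ifP; [left | right].
  move=> s' s'E; rewrite /linv /=.
  (* Completing the square: for t >= 1 and s' <= rho t, the quantity t (rho + 1) - s' is at least 1,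
     so the new curvature is positive. *)
  have -> : 2 * t ^+ 2 * ((rho + 1) ^+ 2 + 2^-1 ^+ 2) - 2 * (2 * s' * t * (rho + 1) + 1 / 2)
     + 2 * s' ^+ 2 = 2 * (s' - t * (rho + 1)) ^+ 2 + t ^+ 2 / 2 - 1 by field.
  case: st => [t0|[t_ge1 s_le]].
    have s'2 : s' ^+ 2 = s ^+ 2 by case: s'E => ->; rewrite ?sqrrN.
    have s2 : s ^+ 2 = 1 by move: q; rewrite t0 expr0n /= mul0r mulr0 !addr0.
    by rewrite t0 mul0r subr0 s'2 s2 expr0n /=; lra.
  have : 1 <= (t * (rho + 1) - s') ^+ 2.
    rewrite exprn_ege1 //; case: s'E => ->; first by lra.
    by have := mulr_ge0 t_ge0 rho_ge0; lra.
  by have := sqr_ge0 t; lra.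
have [->|[->|[->|->]]] : i = p.*2 \/ i = p.*2.+1 \/ i = p.*2.+2 \/ i = p.*2.+3 by nlia.
- by rewrite conf_hub /linv /=; lra.
- exact: cap_gt0.
- apply: lt_le_trans cap_gt0 _; rewrite -subr_ge0.
  have -> : vb (linv (rho + 1) 2^-1 (conf p.*2.+2)) - vb (linv (rho + 1) 2^-1 (conf p.*2.+1))
     = 8 * (rho + 1) / g by rewrite conf_cap1 conf_cap2 /linv /=; field; rewrite h_neq0 g_neq0.
  apply: divr_ge0; last exact: ltW.
  by apply: mulr_ge0 => //; apply: addr_ge0.
rewrite conf_top /linv /=.
have -> : 2 * g ^+ 2 / h * ((rho + 1) ^+ 2 + 2^-1 ^+ 2) - 2 * (0 * (rho + 1) + (g ^+ 2 + 1) / h * 2^-1)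
   + 2 / h = (2 * g ^+ 2 * (rho ^+ 2 + 2 * rho) + 3 / 2 * g ^+ 2 + 1) / h by field.
rewrite divr_gt0 // addr_gt0 // ltr_wpDl //.
  apply: mulr_ge0; first by rewrite mulr_ge0 ?sqr_ge0.
  by apply: addr_ge0; [apply: sqr_ge0 | apply: mulr_ge0].
by apply: mulr_gt0; [lra | apply: exprn_gt0].
Qed.

End Configuration.

Lemma double_wheel_packing n : exists cs rs, circle_packing (@double_wheel n.+2) cs rs.
Proof.
have [u [/andP[u_gt0 u_lt2] cos_eq sin_eq u_ge1]] := exists_angle algR n.
set p := n.+2 in cos_eq sin_eq u_ge1 *.
pose v (i : 'I_(p.*2.+4)) := linv (cheb u p.-1 / cheb u p + 1) 2^-1 (conf u n i).
have lt_v (i j : 'I_(p.*2.+4)) : (i < j)%N ->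
    lprod (v i) (v j) <= -1 /\ (wheel_arc p i j -> lprod (v i) (v j) = -1).
  by move=> ij; rewrite lprod_linv; apply: lprod_conf; rewrite // ij ltn_ord.
have arcE (i j : 'I_(p.*2.+4)) : wheel_arc p i j -> lprod (v i) (v j) = -1.
  by move=> arc_ij; have [_ ->] := lt_v i j (wheel_arc_ltn (isT : 1 < p)%N arc_ij).
apply: (@circle_packing_of_lvec _ _ v) => [i|i|i j|i j].
- exact: conf_vb_gt0.
- by rewrite lprod_linv conf_norm.
- rewrite neq_ltn => /orP[/lt_v[]//|/lt_v[]]; by rewrite lprodC.
by move=> /orP[/arcE//|/arcE]; rewrite lprodC.
Qed.

(** * Rigidity *)

Definition det2 (R : pzRingType) (v w : R * R) : R := v.1 * w.2 - w.1 * v.2.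

(* The quadratic form a x^2 + 2 b x y + c y^2. *)
Record bform (R : Type) := BForm { fa : R; fb : R; fc : R }.

Definition fpol (R : pzRingType) (q : bform R) (v w : R * R) : R :=
  fa q * (v.1 * w.1) + fb q * (v.1 * w.2 + v.2 * w.1) + fc q * (v.2 * w.2).

(** The polarization of the determinant a c - b^2 of a form. *)
Definition fdisc (R : fieldType) (q q' : bform R) : R :=
  (fa q * fc q' + fa q' * fc q) / 2 - fb q * fb q'.

Lemma cheb_opp_sqr (R : comPzRingType) (u : R) n : cheb (- u) n ^+ 2 = cheb u n ^+ 2.
Proof.
suff -> : cheb (- u) n = (-1) ^+ n.+1 * cheb u n by rewrite exprMn sqrr_sign mul1r.
elim/nat_ind2: n => [||n IHn IHSn]; first by rewrite !cheb0 mulr0.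
  by rewrite !cheb1 expr2; ring.
by rewrite !chebSS IHn IHSn !exprS; ring.
Qed.

(** * Quadratic forms equal to 1 along a chain of vectors *)

Section Forms.
Variable R : realFieldType.
Ltac nlia := try clear dependent R; lia.
Implicit Types (q : bform R) (v w z : R * R).

(** The polarized determinant of the Gram matrices in [v], [w], which scales by the square of the
    change of basis. *)
Lemma fdisc_det q q' v w : fdisc q q' * det2 v w ^+ 2
  = (fpol q v v * fpol q' w w + fpol q' v v * fpol q w w) / 2 - fpol q v w * fpol q' v w.
Proof. by rewrite /fdisc /fpol /det2; field. Qed.

Lemma fdisc1_det q v w :
  fdisc q q * det2 v w ^+ 2 = fpol q v v * fpol q w w - fpol q v w ^+ 2.
Proof. by rewrite fdisc_det; field. Qed.

Lemma bform_eq q q' v w : det2 v w != 0 -> fpol q v v = fpol q' v v ->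
  fpol q w w = fpol q' w w -> fpol q v w = fpol q' v w -> q = q'.
Proof.
move=> d0 vv ww vw.
have faE f : fa f * det2 v w ^+ 2
    = w.2 ^+ 2 * fpol f v v - 2 * v.2 * w.2 * fpol f v w + v.2 ^+ 2 * fpol f w w.
  by rewrite /fpol /det2; ring.
have fbE f : fb f * det2 v w ^+ 2 = - w.1 * w.2 * fpol f v v
    + (v.1 * w.2 + v.2 * w.1) * fpol f v w - v.1 * v.2 * fpol f w w.
  by rewrite /fpol /det2; ring.
have fcE f : fc f * det2 v w ^+ 2
    = w.1 ^+ 2 * fpol f v v - 2 * v.1 * w.1 * fpol f v w + v.1 ^+ 2 * fpol f w w.
  by rewrite /fpol /det2; ring.
have d2 : det2 v w ^+ 2 != 0 by rewrite expf_neq0.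
have Ea : fa q = fa q' by apply: (mulIf d2); rewrite !faE vv ww vw.
have Eb : fb q = fb q' by apply: (mulIf d2); rewrite !fbE vv ww vw.
have Ec : fc q = fc q' by apply: (mulIf d2); rewrite !fcE vv ww vw.
by case: q q' Ea Eb Ec {vv ww vw} => a b c [a' b' c'] /= -> -> ->.
Qed.

Lemma cramer2 v w z : det2 v w = 1 -> det2 w z = 1 ->
  z = (det2 v z * w.1 - v.1, det2 v z * w.2 - v.2).
Proof.
move=> vw wz; have -> : v.1 = v.1 * det2 w z by rewrite wz mulr1.
have -> : v.2 = v.2 * det2 w z by rewrite wz mulr1.
rewrite [z in LHS]surjective_pairing; congr (_, _).
  by rewrite -[LHS]mulr1 -vw /det2; ring.
by rewrite -[LHS]mulr1 -vw /det2; ring.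
Qed.

Definition scale2 (a : R) v : R * R := (a * v.1, a * v.2).

(* Both w and -w represent the same disc; the signs are chosen so that
   consecutive determinants are all equal to 1. *)
Fixpoint reorient (w : nat -> R * R) (n : nat) : R * R :=
  if n is n'.+1 then scale2 (det2 (reorient w n') (w n)) (w n) else w 0.

(* A form takes the value 1 at both w(j) and w(j+2) = a w(j+1) - w(j) only if
   a = 0, which disjointness excludes, or a is twice the polar value of the
   form at w(j) and w(j+1), which is therefore constant along the run. *)
Lemma run_cheb q (w : nat -> R * R) p : (1 < p)%N ->
    (forall j, (j <= p)%N -> fpol q (w j) (w j) = 1) ->
    (forall j, (j < p)%N -> det2 (w j) (w j.+1) ^+ 2 = 1) ->
    (forall i k, (0 < k)%N -> (i + k <= p)%N -> 1 <= det2 (w i) (w (i + k)%N) ^+ 2) ->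
  exists u, [/\ 0 < u, u ^+ 2 = 4 * (1 - fdisc q q) &
    forall i k, (i + k <= p)%N -> det2 (w i) (w (i + k)%N) ^+ 2 = cheb u k ^+ 2].
Proof.
move=> p_gt1 qw1 dw1 dw_ge1; pose w' := reorient w.
have sgn j : (j <= p)%N -> exists2 s : R, s ^+ 2 = 1 & w' j = scale2 s (w j).
  elim: j => [_|j IHj jp].
    by exists 1; rewrite ?expr1n // /scale2 !mul1r -surjective_pairing.
  have [s s2 w'j] := IHj (ltnW jp); exists (det2 (w' j) (w j.+1)) => //.
  have -> : det2 (w' j) (w j.+1) = s * det2 (w j) (w j.+1).
    by rewrite w'j /det2 /scale2 /=; ring.
  by rewrite exprMn s2 dw1 // mulr1.
have det_sqr i j : (i <= p)%N -> (j <= p)%N ->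
    det2 (w' i) (w' j) ^+ 2 = det2 (w i) (w j) ^+ 2.
  move=> /sgn[s s2 ->] /sgn[s' s'2 ->].
  rewrite -[RHS]mul1r -[1]mulr1 -{1}s2 -s'2 /det2 /scale2 /=; ring.
have q1 j : (j <= p)%N -> fpol q (w' j) (w' j) = 1.
  move=> jp; have [s s2 ->] := sgn j jp; rewrite -(qw1 j jp) -[RHS]mul1r -s2.
  by rewrite /fpol /scale2 /=; ring.
have d1 j : (j < p)%N -> det2 (w' j) (w' j.+1) = 1.
  move=> jp; have : det2 (w' j) (w j.+1) ^+ 2 = 1.
    have [s s2 ->] := sgn j (ltnW jp); rewrite -(dw1 j jp) -[RHS]mul1r -s2.
    by rewrite /det2 /scale2 /=; ring.
  have -> : det2 (w' j) (w' j.+1) = det2 (w' j) (w j.+1) ^+ 2.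
    have -> : w' j.+1 = scale2 (det2 (w' j) (w j.+1)) (w j.+1) by [].
    by case: (w' j) (w j.+1) => x y [x' y']; rewrite /scale2 /det2 /=; ring.
  by move=> ->.
have step j : (j.+2 <= p)%N ->
  [/\ w' j.+2 = (2 * fpol q (w' j) (w' j.+1) * (w' j.+1).1 - (w' j).1,
                 2 * fpol q (w' j) (w' j.+1) * (w' j.+1).2 - (w' j).2)
    & fpol q (w' j.+1) (w' j.+2) = fpol q (w' j) (w' j.+1)].
  move=> jp; have jp1 := ltnW jp; have jp0 := ltnW jp1.
  have wE := cramer2 (d1 j jp1) (d1 j.+1 jp).
  set a := det2 (w' j) (w' j.+2) in wE; set h := fpol q (w' j) (w' j.+1).
  have a_neq0 : a != 0.
    have : 1 <= a ^+ 2 by rewrite det_sqr // -addn2 dw_ge1 // addn2.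
    by apply: contraTneq => ->; rewrite expr0n -ltNge ltr01.
  have qz : fpol q (w' j.+2) (w' j.+2) = a ^+ 2 * fpol q (w' j.+1) (w' j.+1)
       - 2 * a * h + fpol q (w' j) (w' j) by rewrite wE /h /fpol /=; ring.
  have aE : a = 2 * h.
    apply: (mulfI a_neq0); move: qz; rewrite !q1 //; lra.
  rewrite -aE; split=> //.
  have -> : fpol q (w' j.+1) (w' j.+2) = a * fpol q (w' j.+1) (w' j.+1) - h.
    by rewrite wE /h /fpol /=; ring.
  by rewrite q1 // aE; ring.
set h := fpol q (w' 0%N) (w' 1%N).
have hE j : (j.+1 <= p)%N -> fpol q (w' j) (w' j.+1) = h.
  elim: j => // j IHj jp; have [_ ->] := step j jp; exact/IHj/ltnW.
have detE i k : (i + k <= p)%N -> det2 (w' i) (w' (i + k)%N) = cheb (2 * h) k.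
  elim/nat_ind2: k => [||k IHk IHSk] ikp.
  - by rewrite addn0 cheb0 /det2 subrr.
  - by rewrite addn1 in ikp *; rewrite d1 // cheb1.
  rewrite !addnS in ikp IHSk *; have [-> _] := step _ ikp.
  rewrite hE 1?ltnW // chebSS -IHSk 1?ltnW // -IHk; last exact/ltnW/ltnW.
  by case: (w' i) (w' (i + k).+1) (w' (i + k)%N) => x y [x' y'] [x'' y'']; rewrite /det2 /=; ring.
have h2 : (2 * h) ^+ 2 = 4 * (1 - fdisc q q).
  have := fdisc1_det q (w' 0%N) (w' 1%N); rewrite d1 ?q1 ?(ltnW p_gt1) // expr1n !mulr1.
  by move=> ->; rewrite /h; ring.
have chebE i k : (i + k <= p)%N -> det2 (w i) (w (i + k)%N) ^+ 2 = cheb (2 * h) k ^+ 2.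
  by move=> ikp; rewrite -(detE i) // det_sqr // (leq_trans _ ikp) // leq_addr.
have h_neq0 : 2 * h != 0.
  have := dw_ge1 0%N 2%N isT p_gt1; rewrite chebE // chebSS cheb1 cheb0 mulr1 subr0.
  by apply: contraTneq => ->; rewrite expr0n -ltNge ltr01.
(* The sign of [2 * h] is not controlled, but changing it leaves the squares of Chebyshev values
   unchanged. *)
exists `|2 * h|; rewrite normr_gt0 real_normK ?num_real //; split=> // i k ikp.
by rewrite chebE //; case: ger0P => // _; rewrite cheb_opp_sqr.
Qed.

(** The end discs of a chain determine its angle: before the first sign change the values strictly
    increase with [u]. *)
Lemma cheb_sqr_inj (u1 u2 : R) p : (1 < p)%N -> 0 < u1 -> 0 < u2 ->
    (forall k, (0 < k <= p)%N -> 1 <= cheb u1 k ^+ 2) ->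
    (forall k, (0 < k <= p)%N -> 1 <= cheb u2 k ^+ 2) ->
  cheb u1 p ^+ 2 = cheb u2 p ^+ 2 -> u1 = u2.
Proof.
case: p => [|[|p]] // _ u1_gt0 u2_gt0 /(cheb_ge1_of_sqr u1_gt0) ge1 /(cheb_ge1_of_sqr u2_gt0) ge2.
have pos1 j : (0 < j <= p.+2)%N -> 0 < cheb u1 j by move/ge1; apply: lt_le_trans.
have pos2 j : (0 < j <= p.+2)%N -> 0 < cheb u2 j by move/ge2; apply: lt_le_trans.
move=> /eqP; rewrite eqrXn2 ?ltW ?pos1 ?pos2 ?leqnn // => /eqP eq12.
have [lt12|lt21|//] := ltgtP u1 u2.
  suff : cheb u1 p.+2 < cheb u2 p.+2 by rewrite eq12 ltxx.
  apply: cheb_lt lt12 _ _ => [j jp|]; last by rewrite ltW ?pos1 ?leqnn.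
  by apply: pos1; rewrite /= ltnS leqW.
suff : cheb u2 p.+2 < cheb u1 p.+2 by rewrite eq12 ltxx.
apply: cheb_lt lt21 _ _ => [j jp|]; last by rewrite ltW ?pos2 ?leqnn.
by apply: pos2; rewrite /= ltnS leqW.
Qed.

(* G and the h's express the three forms in the basis of the two common petals. *)
Lemma cap_equations (G D h1 h2 h0 : R) : 1 <= G -> h1 != h2 ->
    D * G = 1 - h1 ^+ 2 -> D * G = 1 - h2 ^+ 2 ->
    G ^+ 2 + (1 - h1 ^+ 2) * (1 - h0 ^+ 2) = 2 * G * (1 - h1 * h0) ->
    G ^+ 2 + (1 - h2 ^+ 2) * (1 - h0 ^+ 2) = 2 * G * (1 - h2 * h0) ->
  G = 1 + (1 - D).
Proof.
move=> G_ge1 neq12 D1 D2.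
have G_neq0 : G != 0 by rewrite gt_eqF // (lt_le_trans ltr01).
have h2E : h2 = - h1.
  have /eqP : h1 ^+ 2 = h2 ^+ 2 by lra.
  rewrite eqf_sqr (negPf neq12) /= => /eqP->; ring.
move=> e1 e2; rewrite h2E in neq12 e2.
have h1_neq0 : h1 != 0 by apply: contraNneq neq12 => ->; rewrite oppr0.
(* With [h2 = - h1], the difference of the two tangency equations is 4 G h1 h0 = 0. *)
have h0E : h0 = 0.
  apply: (mulfI h1_neq0); apply: (mulfI G_neq0).
  rewrite !mulr0; move: e1 e2; rewrite sqrrN; lra.
apply: (mulfI G_neq0); move: e1; rewrite h0E mulr0 expr0n /= subr0 !mulr1 => e1.
lra.
Qed.
(** The two caps have equal [fdisc] because their chains share the end petals; in the basis of these
    petals the three forms differ only in their polar values, and [q1 <> q2] makes the polar values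
    of the caps distinct, as [cap_equations] requires. *)
Lemma wheel_rigidity p (v : nat -> R * R) (q1 q2 q0 : bform R) : (1 < p)%N ->
    (forall i j, (i < p.*2)%N -> (j < p.*2)%N -> i != j -> 1 <= det2 (v i) (v j) ^+ 2) ->
    (forall i j, (i < p.*2)%N -> (j < p.*2)%N -> wheel_arc p i j -> det2 (v i) (v j) ^+ 2 = 1) ->
    (forall j, (j <= p)%N -> fpol q1 (v j) (v j) = 1) ->
    (forall j, (p <= j < p.*2)%N || (j == 0%N) -> fpol q2 (v j) (v j) = 1) ->
    fpol q0 (v 0) (v 0) = 1 -> fpol q0 (v p) (v p) = 1 -> q1 <> q2 ->
    1 + fdisc q1 q1 * fdisc q0 q0 = 2 * fdisc q1 q0 ->
    1 + fdisc q2 q2 * fdisc q0 q0 = 2 * fdisc q2 q0 ->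
  exists u, [/\ 0 < u, u ^+ 2 = 4 * (1 - fdisc q1 q1) & cheb u p ^+ 2 = 1 + u ^+ 2 / 4].
Proof.
move=> p_gt1 v_disj v_arc q1v q2v q00 q0p neq12 tan1 tan2.
have det2C (x y : R * R) : det2 x y ^+ 2 = det2 y x ^+ 2 by rewrite /det2; ring.
have [||u1 [u1_gt0 u1E cheb1E]] := @run_cheb q1 v p p_gt1 q1v.
- by move=> j jp; apply: v_arc; rewrite /wheel_arc ?eqxx /=; nlia.
- by move=> i k k_gt0 ikp; apply: v_disj; nlia.
(* The second half of the ring, traversed backwards from petal 0 through 2p - 1 down to p. *)
pose w j := if j == 0%N then v 0 else v (p.*2 - j)%N.
have w0 : w 0 = v 0 by [].
have wS j : w j.+1 = v (p.*2 - j.+1)%N by [].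
have wp : w p = v p by rewrite /w; case: eqP p_gt1 => [->//|_ _]; congr v; nlia.
have [|||u2 [u2_gt0 u2E cheb2E]] := @run_cheb q2 w p p_gt1.
- case=> [_|j jp]; first by rewrite w0 q2v // orbT.
  by rewrite wS q2v //; nlia.
- case=> [|j] jp; rewrite ?w0 ?wS; first by apply: v_arc; rewrite /wheel_arc; nlia.
  by rewrite det2C; apply: v_arc; rewrite /wheel_arc; nlia.
- case=> [|i] [|k] // _ ikp; first by rewrite add0n w0 wS; apply: v_disj; nlia.
  by rewrite addSn !wS; apply: v_disj; nlia.
have g_eq : cheb u1 p ^+ 2 = cheb u2 p ^+ 2 by rewrite -(cheb1E 0) // -(cheb2E 0) // !add0n wp.
have u12 : u1 = u2.
  apply: cheb_sqr_inj p_gt1 u1_gt0 u2_gt0 _ _ g_eq => k /andP[k_gt0 kp].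
    by rewrite -(cheb1E 0) ?add0n //; apply: v_disj; nlia.
  rewrite -(cheb2E 0) ?add0n // w0; case: k k_gt0 kp => // k _ kp; rewrite wS.
  by apply: v_disj; nlia.
have D12 : fdisc q2 q2 = fdisc q1 q1 by move: u1E u2E; rewrite u12; lra.
have GE : det2 (v 0) (v p) ^+ 2 = cheb u1 p ^+ 2 by rewrite -(cheb1E 0).
have G_ge1 : 1 <= det2 (v 0) (v p) ^+ 2 by apply: v_disj; nlia.
have det_neq0 : det2 (v 0) (v p) != 0.
  by apply: contraTneq G_ge1 => ->; rewrite expr0n -ltNge ltr01.
exists u1; split=> //; rewrite -GE.
have q10 := q1v 0 isT; have q1p := q1v p (leqnn p).
have q20 : fpol q2 (v 0) (v 0) = 1 by apply: q2v; rewrite orbT.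
have q2p : fpol q2 (v p) (v p) = 1 by apply: q2v; nlia.
have hne : fpol q1 (v 0) (v p) != fpol q2 (v 0) (v p).
  by apply/eqP => h12; apply: neq12; apply: bform_eq det_neq0 _ _ h12; rewrite ?q10 ?q1p.
have E1 := fdisc1_det q1 (v 0) (v p); have E2 := fdisc1_det q2 (v 0) (v p).
have E0 := fdisc1_det q0 (v 0) (v p).
have P1 := fdisc_det q1 q0 (v 0) (v p); have P2 := fdisc_det q2 q0 (v 0) (v p).
rewrite q10 q1p q20 q2p q00 q0p !mulr1 in E1 E2 E0 P1 P2.
have -> : u1 ^+ 2 / 4 = 1 - fdisc q1 q1 by rewrite u1E; field.
set G := det2 (v 0) (v p) ^+ 2 in G_ge1 E1 E2 E0 P1 P2 *.
apply: (@cap_equations G _ _ _ (fpol q0 (v 0) (v p)) G_ge1 hne E1).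
- by rewrite -D12.
- rewrite -E1 -E0; have -> : 2 * G * (1 - fpol q1 (v 0) (v p) * fpol q0 (v 0) (v p))
    = G * (2 * (fdisc q1 q0 * G)) by rewrite P1; field.
  have -> : G * (2 * (fdisc q1 q0 * G)) = G ^+ 2 * (2 * fdisc q1 q0) by ring.
  by rewrite -tan1; ring.
rewrite -E2 -E0; have -> : 2 * G * (1 - fpol q2 (v 0) (v p) * fpol q0 (v 0) (v p))
  = G * (2 * (fdisc q2 q0 * G)) by rewrite P2; field.
have -> : G * (2 * (fdisc q2 q0 * G)) = G ^+ 2 * (2 * fdisc q2 q0) by ring.
by rewrite -tan2; ring.
Qed.

End Forms.

(* A square root of the complex number a + i b of modulus k. *)
Definition csqrt (R : rcfType) (a b k : R) : R * R :=
  (Num.sqrt ((k + a) / 2), (if 0 <= b then 1 else -1) * Num.sqrt ((k - a) / 2)).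

Lemma csqrtP (R : rcfType) (a b k : R) (z := csqrt a b k) :
    0 <= k -> k ^+ 2 = a ^+ 2 + b ^+ 2 ->
  [/\ z.1 ^+ 2 - z.2 ^+ 2 = a, 2 * z.1 * z.2 = b & z.1 ^+ 2 + z.2 ^+ 2 = k].
Proof.
move=> k_ge0 kE; have : `|a| <= k.
  by rewrite -(ler_pXn2r (_ : 0 < 2)%N) ?nnegrE // real_normK ?num_real // kE lerDl sqr_ge0.
rewrite ler_norml => /andP[ka_ge0 ak_ge0].
have p1 : 0 <= (k + a) / 2 by lra.
have p2 : 0 <= (k - a) / 2 by lra.
have x2 : z.1 ^+ 2 = (k + a) / 2 by rewrite sqr_sqrtr.
have y2 : z.2 ^+ 2 = (k - a) / 2.
  by rewrite exprMn sqr_sqrtr //; case: ifP => _; rewrite ?sqrrN expr1n mul1r.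
split; [by rewrite x2 y2; field | | by rewrite x2 y2; field].
have xy : Num.sqrt ((k + a) / 2) * Num.sqrt ((k - a) / 2) = `|b| / 2.
  rewrite -sqrtrM // (_ : (k + a) / 2 * ((k - a) / 2) = (b / 2) ^+ 2); last by lra.
  by rewrite sqrtr_sqr normrM (@ger0_norm _ 2^-1) // invr_ge0.
have -> : 2 * z.1 * z.2 = (if 0 <= b then 1 else -1)
    * (2 * (Num.sqrt ((k + a) / 2) * Num.sqrt ((k - a) / 2))) by rewrite /z /csqrt /=; ring.
by rewrite xy; case: (ger0P b) => _; field.
Qed.

(** * Spinors and forms attached to an arbitrary packing *)

Section Discs.
Variables (R : rcfType) (p : nat) (X Y r : nat -> R).
Let hub := p.*2.
Let d2 i j := (X i - X j) ^+ 2 + (Y i - Y j) ^+ 2.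
Hypothesis p_gt1 : (1 < p)%N.
Hypothesis r_gt0 : forall i, (i < p.*2.+4)%N -> 0 < r i.
Hypothesis disj : forall i j, (i < p.*2.+4)%N -> (j < p.*2.+4)%N -> i != j ->
  (r i + r j) ^+ 2 <= d2 i j.
Hypothesis tang : forall i j, (i < p.*2.+4)%N -> (j < p.*2.+4)%N -> wheel_arc p i j ->
  d2 i j = (r i + r j) ^+ 2.

Ltac nlia := try clear dependent R; lia.

Let rh_gt0 : 0 < r hub. Proof. by apply: r_gt0; rewrite /hub; nlia. Qed.
Let rh_neq0 : r hub != 0. Proof. exact: lt0r_neq0. Qed.

(* The spinor of a disc tangent to the hub: its square points from the center
   of the hub to the tangency point. *)
Definition spinor (j : nat) : R * R :=
  csqrt ((X j - X hub) / r j) ((Y j - Y hub) / r j) ((r hub + r j) / r j).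

Lemma spinorP j (z := spinor j) : (j < p.*2)%N ->
  [/\ z.1 ^+ 2 - z.2 ^+ 2 = (X j - X hub) / r j, 2 * z.1 * z.2 = (Y j - Y hub) / r j
    & z.1 ^+ 2 + z.2 ^+ 2 = (r hub + r j) / r j].
Proof.
move=> jp; have rj_gt0 : 0 < r j by apply: r_gt0; nlia.
apply: csqrtP; first by rewrite divr_ge0 ?addr_ge0 ?ltW.
rewrite !exprMn -mulrDl; congr (_ * _); rewrite addrC.
have := @tang j hub; rewrite /d2 => -> //; rewrite /wheel_arc /hub; nlia.
Qed.

(** The law of cosines in the triangle formed by the centers of the hub and the two petals; the
    right side is their inversive distance, free of the hub and of the signs of the spinors. *)
Lemma det2_spinor i j : (i < p.*2)%N -> (j < p.*2)%N ->
  det2 (spinor i) (spinor j) ^+ 2 = 1 + (d2 i j - (r i + r j) ^+ 2) / (4 * r i * r j).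
Proof.
move=> ip jp; have [ai bi ki] := spinorP ip; have [aj bj kj] := spinorP jp.
have ri_neq0 : r i != 0 by rewrite lt0r_neq0 ?r_gt0 //; nlia.
have rj_neq0 : r j != 0 by rewrite lt0r_neq0 ?r_gt0 //; nlia.
have Ti : d2 i hub = (r i + r hub) ^+ 2 by apply: tang; rewrite /wheel_arc /hub; nlia.
have Tj : d2 j hub = (r j + r hub) ^+ 2 by apply: tang; rewrite /wheel_arc /hub; nlia.
have -> : det2 (spinor i) (spinor j) ^+ 2 = ((r hub + r i) / r i * ((r hub + r j) / r j)
    - (X i - X hub) / r i * ((X j - X hub) / r j)
    - (Y i - Y hub) / r i * ((Y j - Y hub) / r j)) / 2.
  by rewrite -ai -aj -bi -bj -ki -kj /det2; field.
have -> : d2 i j = d2 i hub + d2 j hub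
    - 2 * ((X i - X hub) * (X j - X hub) + (Y i - Y hub) * (Y j - Y hub)) by rewrite /d2; ring.
by rewrite Ti Tj; field; rewrite ri_neq0 rj_neq0.
Qed.

(** The squared length of a common external tangent of the hub and [b], divided by the hub
    radius. *)
Definition cap_size (b : nat) : R := (d2 b hub - (r hub - r b) ^+ 2) / r hub.

(* The form takes the value 1 exactly at the spinors of the petals tangent to b. *)
Definition cap_form (b : nat) : bform R :=
  let s := cap_size b + 2 * (r hub - r b) in
  BForm ((s - 2 * (X b - X hub)) / cap_size b) (- (2 * (Y b - Y hub)) / cap_size b)
    ((s + 2 * (X b - X hub)) / cap_size b).

Lemma cap_size_gt0 b : (p.*2 < b < p.*2.+4)%N -> 0 < cap_size b.
Proof.
move=> /andP[pb bp]; rewrite divr_gt0 //.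
have rb := r_gt0 bp; have : (r b + r hub) ^+ 2 <= d2 b hub by apply: disj; rewrite /hub; nlia.
have := mulr_gt0 rb rh_gt0; nra.
Qed.

(** Once tangency to the hub is used, tangency of [j] and [b] is linear in the center offset and in
    [r hub + r j]; divided by [r j], these are quadratic in the spinor. *)
Lemma cap_form_spinor b j : (p.*2 < b < p.*2.+4)%N -> (j < p.*2)%N -> wheel_arc p j b ->
  fpol (cap_form b) (spinor j) (spinor j) = 1.
Proof.
move=> /andP[pb bp] jp jb; have [aj bj kj] := spinorP jp.
have T_neq0 : cap_size b != 0 by rewrite lt0r_neq0 // cap_size_gt0 // pb.
have rj_neq0 : r j != 0 by rewrite lt0r_neq0 ?r_gt0 //; nlia.
have Tj : d2 j hub = (r j + r hub) ^+ 2 by apply: tang; rewrite /wheel_arc /hub; nlia.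
have Tb : d2 j b = (r j + r b) ^+ 2 by apply: tang => //; nlia.
apply: (mulIf T_neq0); rewrite mul1r.
have -> : fpol (cap_form b) (spinor j) (spinor j) * cap_size b =
   (cap_size b + 2 * (r hub - r b)) * ((r hub + r j) / r j)
    - 2 * (X b - X hub) * ((X j - X hub) / r j) - 2 * (Y b - Y hub) * ((Y j - Y hub) / r j).
  by rewrite -aj -bj -kj /fpol /cap_form /=; field.
have E : 2 * ((X b - X hub) * (X j - X hub) + (Y b - Y hub) * (Y j - Y hub))
    = d2 b hub + d2 j hub - d2 j b by rewrite /d2; ring.
have dE : d2 b hub = cap_size b * r hub + (r hub - r b) ^+ 2 by rewrite /cap_size divfK // subrK.
have -> : (cap_size b + 2 * (r hub - r b)) * ((r hub + r j) / r j)
    - 2 * (X b - X hub) * ((X j - X hub) / r j) - 2 * (Y b - Y hub) * ((Y j - Y hub) / r j)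
  = ((cap_size b + 2 * (r hub - r b)) * (r hub + r j)
     - 2 * ((X b - X hub) * (X j - X hub) + (Y b - Y hub) * (Y j - Y hub))) / r j by field.
by rewrite E dE Tj Tb; field.
Qed.

Lemma fdisc_cap b b' : (p.*2 < b < p.*2.+4)%N -> (p.*2 < b' < p.*2.+4)%N ->
  fdisc (cap_form b) (cap_form b') = 1 - 2 * r b / cap_size b - 2 * r b' / cap_size b'
    + 2 * (d2 b b' - (r b - r b') ^+ 2) / (cap_size b * cap_size b').
Proof.
move=> /cap_size_gt0/lt0r_neq0 T /cap_size_gt0/lt0r_neq0 T'.
have dE c : d2 c hub = cap_size c * r hub + (r hub - r c) ^+ 2.
  by rewrite /cap_size divfK // subrK.
have E : d2 b b' = d2 b hub + d2 b' hub
   - 2 * ((X b - X hub) * (X b' - X hub) + (Y b - Y hub) * (Y b' - Y hub)) by rewrite /d2; ring.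
by rewrite E !dE /fdisc /cap_form /=; field; rewrite T T'.
Qed.

Lemma fdisc_cap_diag b : (p.*2 < b < p.*2.+4)%N ->
  fdisc (cap_form b) (cap_form b) = 1 - 4 * r b / cap_size b.
Proof.
move=> bp; rewrite fdisc_cap // (_ : d2 b b = 0); last by rewrite /d2; ring.
by field; rewrite lt0r_neq0 ?cap_size_gt0.
Qed.

(** With x = 2 r / T for each disc, T its [cap_size], both sides are 2 - 2x - 2x' + 4xx'. *)
Lemma cap_tangent b b' : (p.*2 < b < p.*2.+4)%N -> (p.*2 < b' < p.*2.+4)%N ->
    d2 b b' = (r b + r b') ^+ 2 ->
  1 + fdisc (cap_form b) (cap_form b) * fdisc (cap_form b') (cap_form b')
    = 2 * fdisc (cap_form b) (cap_form b').
Proof.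
move=> bp b'p E; rewrite !fdisc_cap_diag // fdisc_cap // E.
by field; rewrite !lt0r_neq0 ?cap_size_gt0.
Qed.

(** Equal forms have equal determinants, which forces the distance of the centers to be the
    difference of the radii, against disjointness. *)
Lemma cap_form_inj b b' : (p.*2 < b < p.*2.+4)%N -> (p.*2 < b' < p.*2.+4)%N ->
  b != b' -> cap_form b <> cap_form b'.
Proof.
move=> bp b'p neq_b q_eq; have Tb := lt0r_neq0 (cap_size_gt0 bp).
have Tb' := lt0r_neq0 (cap_size_gt0 b'p).
have := fdisc_cap bp b'p; rewrite -q_eq fdisc_cap_diag //.
have := fdisc_cap_diag b'p; rewrite -q_eq fdisc_cap_diag // => e1 e2.
have e3 : 2 * (d2 b b' - (r b - r b') ^+ 2) / (cap_size b * cap_size b') = 0.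
  have : 4 * r b / cap_size b = 4 * r b' / cap_size b' by lra.
  have -> : 4 * r b / cap_size b = 2 * (2 * r b / cap_size b) by field.
  have -> : 4 * r b' / cap_size b' = 2 * (2 * r b' / cap_size b') by field.
  move: e2; have -> : 4 * r b / cap_size b = 2 * (2 * r b / cap_size b) by field.
  lra.
have d2E : d2 b b' = (r b - r b') ^+ 2.
  have e4 : 2 * (d2 b b' - (r b - r b') ^+ 2) = 0.
    by apply: (mulIf (invr_neq0 (mulf_neq0 Tb Tb'))); rewrite mul0r.
  lra.
have [[_ bp'] [_ b'p']] := (andP bp, andP b'p).
have := disj bp' b'p' neq_b; rewrite d2E.
have := mulr_gt0 (r_gt0 bp') (r_gt0 b'p'); nra.
Qed.

Lemma double_wheel_cheb : exists u, [/\ 0 < u,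
    u ^+ 2 = 16 * r hub * r hub.+1 / (d2 hub.+1 hub - (r hub - r hub.+1) ^+ 2)
  & cheb u p ^+ 2 = 1 + u ^+ 2 / 4].
Proof.
have cap1 : (p.*2 < hub.+1 < p.*2.+4)%N by rewrite /hub; nlia.
have cap2 : (p.*2 < hub.+2 < p.*2.+4)%N by rewrite /hub; nlia.
have cap3 : (p.*2 < hub.+3 < p.*2.+4)%N by rewrite /hub; nlia.
have pos i j : (i < p.*2)%N -> (j < p.*2)%N -> 0 < 4 * r i * r j.
  by move=> ip jp; rewrite !mulr_gt0 ?r_gt0 //; nlia.
have [|||||||||u [u_gt0 uE chebE]] :=
  @wheel_rigidity R p spinor (cap_form hub.+1) (cap_form hub.+2) (cap_form hub.+3) p_gt1.
- move=> i j ip jp ij; rewrite det2_spinor // lerDl divr_ge0 ?(ltW (pos _ _ ip jp)) //.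
  by rewrite subr_ge0 disj //; nlia.
- move=> i j ip jp ij; rewrite det2_spinor // tang ?subrr ?mul0r ?addr0 //; nlia.
- by move=> j jp; apply: cap_form_spinor => //; rewrite /wheel_arc /hub; nlia.
- by move=> j jp; apply: cap_form_spinor => //; rewrite /wheel_arc /hub; nlia.
- by apply: cap_form_spinor => //; rewrite /wheel_arc ?inE /hub; nlia.
- by apply: cap_form_spinor => //; rewrite /wheel_arc ?inE /hub; nlia.
- by apply: cap_form_inj => //; nlia.
- by apply: cap_tangent => //; apply: tang; rewrite /wheel_arc ?inE /hub; nlia.
- by apply: cap_tangent => //; apply: tang; rewrite /wheel_arc ?inE /hub; nlia.
exists u; split=> //; rewrite uE fdisc_cap_diag // /cap_size.
have := cap_size_gt0 cap1; rewrite /cap_size => /lt0r_neq0.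
rewrite mulf_eq0 invr_eq0 (negPf rh_neq0) orbF => nz.
by field; rewrite rh_neq0 nz.
Qed.
End Discs.

(** * The lower bound *)

(** Both neighbours of the odd index p = 2m + 3 are even, so Cassini and the doubling formula turn
    the product of their values into u^2 times values at [u ^+ 2 - 2]. *)
Lemma cheb_consecutive (R : numFieldType) (u : R) m : u != 0 ->
    cheb u m.*2.+3 ^+ 2 = 1 + u ^+ 2 / 4 ->
  4 * (cheb (u ^+ 2 - 2) m.+2 * cheb (u ^+ 2 - 2) m.+1) = 1.
Proof.
move=> u_neq0 sqrE; have := cheb_cassini u m.*2.+2; rewrite sqrE.
have -> : m.*2.+4 = (2 * m.+2)%N by lia.
have -> : m.*2.+2 = (2 * m.+1)%N by lia.
rewrite !cheb_double; set a := cheb _ m.+2; set b := cheb _ m.+1 => cassini.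
have u2_neq0 : u ^+ 2 / 4 != 0 by rewrite mulf_neq0 ?expf_neq0 ?invr_eq0 ?pnatr_eq0.
apply: (mulfI u2_neq0); rewrite mulr1.
have -> : u ^+ 2 / 4 * (4 * (a * b)) = u * a * (u * b) by field.
by rewrite -[LHS](subKr (1 + u ^+ 2 / 4)) cassini; ring.
Qed.

(** This is [u ^+ 2 - 2] for the hub [a] and the first cap [b]; the squared distance is written with
    a conjugate so as to stay in the generated field. *)
Definition out_cos (ca cb ra rb : algC) : algC :=
  16 * ra * rb / ((cb - ca) * (cb - ca)^* - (ra - rb) ^+ 2) - 2.

Lemma packing_cos m (p := m.*2.+3) (cs rs : 'I_(p.*2.+4) -> algC) (a := inord p.*2) (b := inord p.*2.+1) :
    circle_packing (@double_wheel p) cs rs ->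
  let t := out_cos (cs a) (cs b) (rs a) (rs b) in 4 * (cheb t m.+2 * cheb t m.+1) = 1.
Proof.
move=> [rs_gt0 [cs_disj cs_tang]] t.
pose X i := in_algR (Creal_Re (cs (inord i))); pose Y i := in_algR (Creal_Im (cs (inord i))).
pose r i := in_algR (Creal_Re (rs (inord i))).
have rE i : algRval (r i) = rs (inord i) by apply/Creal_ReP/gtr0_real/rs_gt0.
have dE i j : algRval ((X i - X j) ^+ 2 + (Y i - Y j) ^+ 2) = `|cs (inord i) - cs (inord j)| ^+ 2.
  by rewrite normC2_Re_Im !raddfB.
have sE i j : algRval ((r i + r j) ^+ 2) = (rs (inord i) + rs (inord j)) ^+ 2.
  by rewrite -!rE.
have [|||| u [u_gt0 uE sqrE]] := @double_wheel_cheb algR p X Y r.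
- by [].
- by move=> i ip; have := rs_gt0 (inord i); rewrite -rE.
- move=> i j ip jp ij; have /cs_disj : (inord i : 'I_(p.*2.+4)) != inord j.
    by rewrite -val_eqE /= !inordK.
  have sum_ge0 : 0 <= rs (inord i) + rs (inord j) by rewrite addr_ge0 // ltW.
  rewrite -(@ler_pXn2r _ 2) ?nnegrE ?normr_ge0 // => le_ij.
  suff : algRval ((r i + r j) ^+ 2) <= algRval ((X i - X j) ^+ 2 + (Y i - Y j) ^+ 2) by [].
  by rewrite sE dE.
- move=> i j ip jp ij; apply: (val_inj (_ : algRval _ = algRval _)).
  by rewrite dE sE cs_tang // /double_wheel !inordK // ij.
have -> : t = algRval (u ^+ 2 - 2).
  rewrite rmorphB rmorph_nat uE fmorph_div !rmorphM rmorphB rmorph_nat.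
  rewrite /t /out_cos -normCK -dE -!rE.
  by rewrite rmorphXn [X in _ = _ / (_ - X ^+ 2) - _]rmorphB.
rewrite -!rmorph_cheb -rmorphM -(rmorph_nat algRval) -rmorphM.
by rewrite cheb_consecutive ?rmorph1 // lt0r_neq0.
Qed.

Lemma out_cos_generated s ca cb ra rb : conj_closed s -> generated s ca -> generated s cb ->
  generated s ra -> generated s rb -> generated s (out_cos ca cb ra rb).
Proof.
move=> Js Ga Gb Gra Grb; have fG := generated_subfield s; have Gn := subfield_nat fG.
have Gd := subfieldB fG Gb Ga.
have Gden := subfieldB fG (subfieldM fG Gd (generated_conj Js Gd)) (subfieldX fG 2 (subfieldB fG Gra Grb)).
exact: (subfieldB fG (subfield_div fG (subfieldM fG (subfieldM fG (Gn 16) Gra) Grb) Gden) (Gn 2)).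
Qed.

Lemma double_wheel_degree m t : prime m.*2.+1 ->
  constructs_packing (@double_wheel m.*2.+3) t -> (m.*2.+1 <= rdegree t)%N.
Proof.
move=> q_pr [[out run_out] /(_ _ run_out)[sz_out pack]].
have := packing_cos pack; set x := out_cos _ _ _ _ => /= xE.
apply: (run_degree run_out q_pr _ (cheb_degree xE)) => s Js Gout.
have nth_out (i : 'I_(m.*2.+3.*2.+4)) : nth (0, 0) out i \in out.
  by apply: mem_nth; rewrite sz_out.
suff Gx : generated s x by exact: (subfieldV (generated_subfield s) Gx).
have Gi (i : 'I_(m.*2.+3.*2.+4)) := Gout _ (nth_out i).
exact: out_cos_generated Js (proj1 (Gi _)) (proj1 (Gi _)) (proj2 (Gi _)) (proj2 (Gi _)).
Qed.

Lemma weaken_exponent (R : numDomainType) (c n d : R) a b : 0 <= c -> 1 <= n -> 0 <= d ->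
  (a <= b)%N -> c * n <= d -> c ^+ b * n ^+ a <= d ^+ b.
Proof.
move=> c_ge0 n_ge1 d_ge0 ab cn_d; have n_ge0 := le_trans ler01 n_ge1.
apply: le_trans (_ : (c * n) ^+ b <= _); last first.
  by apply: lerXn2r; rewrite // nnegrE ?mulr_ge0.
by rewrite exprMn ler_wpM2l ?exprn_ge0 // ler_weXn2l.
Qed.

Lemma linear_degree_graphs (N : nat) : exists (n : nat) (e : rel 'I_n),
  [/\ (maxn N 1 <= n)%N, simple_graph e, exists cs rs : 'I_n -> algC, circle_packing e cs rs
    & forall t : rtree, constructs_packing e t -> (n <= 5 * rdegree t)%N].
Proof.
have [q q_gt q_pr] := prime_above (N + 2).
have q_odd : odd q by case: (even_prime q_pr) => // q2; lia.
have Dq : q = q./2.*2.+1 by rewrite -[LHS]odd_double_half q_odd.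
move: q_pr q_gt; rewrite Dq; move: q./2 => m {q q_odd Dq} q_pr q_gt.
exists _, (@double_wheel m.*2.+3); split; first lia.
- exact: double_wheel_simple.
- exact: double_wheel_packing.
(* The constant 5: with q = 2m + 1 >= 3, the number of vertices is 4m + 10 = 2q + 8 <= 5q. *)
by move=> t /(double_wheel_degree q_pr); lia.
Qed.

Lemma degree_lower_bound (a b : nat) : (a <= b)%N -> exists c : rat, 0 < c /\
  forall N : nat, exists (n : nat) (e : rel 'I_n),
    (N <= n)%N /\ simple_graph e /\
    (exists cs rs : 'I_n -> algC, circle_packing e cs rs) /\
    forall t : rtree, constructs_packing e t ->
      c ^+ b * (n%:R) ^+ a <= (rdegree t)%:R ^+ b.
Proof.
move=> le_ab; have c_gt0 : 0 < 5^-1 :> rat by rewrite invr_gt0.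
exists 5^-1; split=> // N.
have [n [e [n_ge simple_e pack_e deg_e]]] := linear_degree_graphs N.
move: n_ge; rewrite geq_max => /andP[Nn n_gt0].
exists n, e; do 3 split=> //; move=> t /deg_e deg_t.
apply: weaken_exponent; rewrite ?ler0n ?ler1n ?(ltW c_gt0) //.
by rewrite mulrC ler_pdivrMr // -natrM ler_nat mulnC.
Qed.

(* c * n^0.677 <= d is written as c^1000 * n^677 <= d^1000 (all nonnegative). *)
Theorem theorem11 :
  (exists c : rat, 0 < c /\
    forall N : nat, exists (n : nat) (e : rel 'I_n),
      (N <= n)%N /\ simple_graph e /\
      (exists cs rs : 'I_n -> algC, circle_packing e cs rs) /\
      forall t : rtree, constructs_packing e t ->
        c ^+ 1000 * (n%:R) ^+ 677 <= (rdegree t)%:R ^+ 1000)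
  /\
  ((forall N : nat, exists p : nat, (N <= p)%N /\ sophie_germain p) ->
   exists c : rat, 0 < c /\
    forall N : nat, exists (n : nat) (e : rel 'I_n),
      (N <= n)%N /\ simple_graph e /\
      (exists cs rs : 'I_n -> algC, circle_packing e cs rs) /\
      forall t : rtree, constructs_packing e t ->
        c * n%:R <= (rdegree t)%:R).
Proof.
split=> [|_]; first exact: (@degree_lower_bound 677 1000 isT).
exact: (@degree_lower_bound 1 1 isT).
Qed.
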